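(* For every positive integer $n$ and every generic convex drawing $D$ of the complete graph $K_n$, the drawing $D$ contains a $5$-face if and only if $n \geq 5$.
   Context: A rectilinear drawing $D$ of $K_n$ represents the vertices of $K_n$ by $n$ distinct points in the plane $\mathbb{R}^2$, no three of which lie on a common line, and represents each edge by the line segment connecting the points representing its end-vertices. The drawing $D$ is convex if the points representing the vertices are in convex position. A heavy crossing in $D$ is a common interior point of at least three edges (segments) of $D$ where they properly cross; $D$ is generic if it has no heavy crossings. Identify $D$ with the union of its points and segments. A face of $D$ is a non-empty connected component of $\mathbb{R}^2 \setminus D$. Exactly one face is unbounded, and every bounded face is (the interior of) a convex polygon; the size of a bounded face is the number of vertices (corners) of this polygon. A bounded face of size $k$ is called a $k$-face of $D$. *)

(* Defs.v *)
From HB Require Import structures.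
From mathcomp Require Import all_boot all_order all_algebra.
From mathcomp Require Import all_classical all_reals all_analysis.

Set Implicit Arguments.
Unset Strict Implicit.
Unset Printing Implicit Defensive.

Import Order.TTheory GRing.Theory Num.Theory.
Import numFieldNormedType.Exports.

Local Open Scope classical_set_scope.
Local Open Scope ring_scope.

Notation plane R := (R * R)%type (only parsing).

Definition is_line (R : realType) (L : set (plane R)) : Prop :=
  exists o u : plane R, u != 0 /\ L = [set o + t *: u | t in [set: R]].

Definition closed_segment (R : realType) (a b : plane R) : set (plane R) :=
  [set (1 - t) *: a + t *: b | t in `[0, 1]%classic].

Definition open_segment (R : realType) (a b : plane R) : set (plane R) :=
  [set (1 - t) *: a + t *: b | t in `]0, 1[%classic].

Definition convex_hull (R : realType) (A : set (plane R)) : set (plane R) :=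
  smallest (@convex_set R (plane R)) A.

Definition convex_position (R : realType) (k : nat) (v : 'I_k -> plane R) :
    Prop :=
  forall i, ~ convex_hull (v @` [set j | j != i]) (v i).

(* As a closed region, with exactly k corners. *)
Definition convex_polygon (R : realType) (k : nat) (P : set (plane R)) : Prop :=
  (3 <= k)%N /\
  exists v : 'I_k -> plane R, convex_position v /\ P = convex_hull (range v).

Record rectilinear_drawing (R : realType) (n : nat) := RectilinearDrawing {
  vertex :> 'I_n -> plane R;
  vertex_inj : injective vertex;
  vertex_general : forall (L : set (plane R)) (i j k : 'I_n), is_line L ->
    i != j -> j != k -> i != k -> ~ [/\ L (vertex i), L (vertex j) & L (vertex k)]
}.

(* The edge {i, j} of K_n is encoded as the pair (i, j) with i < j. *)
Definition edges (n : nat) : set ('I_n * 'I_n) :=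
  [set e : 'I_n * 'I_n | (e.1 < e.2)%N].

Definition edge_segment (R : realType) (n : nat)
    (D : rectilinear_drawing R n) (e : 'I_n * 'I_n) : set (plane R) :=
  closed_segment (D e.1) (D e.2).

Definition edge_interior (R : realType) (n : nat)
    (D : rectilinear_drawing R n) (e : 'I_n * 'I_n) : set (plane R) :=
  open_segment (D e.1) (D e.2).

Definition drawing_set (R : realType) (n : nat)
    (D : rectilinear_drawing R n) : set (plane R) :=
  range D `|` \bigcup_(e in @edges n) edge_segment D e.

Definition convex_drawing (R : realType) (n : nat)
    (D : rectilinear_drawing R n) : Prop := convex_position D.

(* Two segments sharing a relative interior point cross properly there unless
   they lie on a common line. *)
Definition properly_cross_at (R : realType) (n : nat)
    (D : rectilinear_drawing R n) (e f : 'I_n * 'I_n) (p : plane R) : Prop :=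
  [/\ edge_interior D e p, edge_interior D f p &
      ~ exists L : set (plane R),
          [/\ is_line L, edge_segment D e `<=` L & edge_segment D f `<=` L]].

Definition heavy_crossing (R : realType) (n : nat)
    (D : rectilinear_drawing R n) (p : plane R) : Prop :=
  exists e f g : 'I_n * 'I_n,
    [/\ edges e, edges f, edges g & uniq [:: e; f; g]] /\
    [/\ properly_cross_at D e f p, properly_cross_at D f g p &
        properly_cross_at D e g p].

Definition generic_drawing (R : realType) (n : nat)
    (D : rectilinear_drawing R n) : Prop :=
  forall p, ~ heavy_crossing D p.

Definition is_face (R : realType) (n : nat)
    (D : rectilinear_drawing R n) (F : set (plane R)) : Prop :=
  exists x, (~` drawing_set D) x /\
    F = connected_component (~` drawing_set D) x.

Definition is_kface (R : realType) (n : nat)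
    (D : rectilinear_drawing R n) (k : nat) (F : set (plane R)) : Prop :=
  [/\ is_face D F, bounded_set F &
      exists P : set (plane R), convex_polygon k P /\ F = interior P].

(* Main.v *)
(* The proof is by discharging. Cutting the convex n-gon of the vertices successively along its diagonals
   produces the bounded faces as explicit convex polygons. When a polygon of size k is cut through z of
   its corners, the sizes of the two parts add up to k + 4 - z; hence the sum of 4 - |P| over all faces P
   increases by z in each cut, and it ends at (n - 2)^2.
   Give every side ab of a face P the sign +1, 0 or -1 according to whether the two chords that continue the
   boundary of P at a and at b converge, are parallel or diverge on the side of P. If a and b are crossings,
   the face on the other side of ab sees the same two chords (there are no heavy crossings), so the two signs
   cancel; only sides with an endpoint among the n vertices survive, and there are at most 2n(n - 3) + n of
   these. On the other hand, the signs of a face P sum to at least 3(4 - |P|) unless |P| = 5: a triangle has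
   three converging sides, opposite sides of a quadrangle cancel, and -|P| >= 3(4 - |P|) if |P| >= 6. Without a
   5-face this gives 3(n - 2)^2 <= 2n(n - 3) + n, that is (n - 3)(n - 4) <= 0.
   Conversely, each corner of a face is a vertex or lies on two edges, and a convex drawing with at most 4
   vertices has at most one crossing, which lies between two vertices. *)

Require Import Defs.
From mathcomp Require Import all_boot all_order all_algebra.
From mathcomp Require Import all_classical all_reals all_analysis.
From mathcomp Require Import ring lra zify.

Set Implicit Arguments.
Unset Strict Implicit.
Unset Printing Implicit Defensive.

Import Order.TTheory GRing.Theory Num.Theory.
Import numFieldNormedType.Exports.

(** * Convex polygons and their cuts by a line *)

Section Polygons.
Local Open Scope ring_scope.
Variable R : realFieldType.
Notation pt := (R * R)%type.
Implicit Types (a b c d p q u v x y : pt) (P A B C s t : seq pt).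

(** Neither Euler's formula nor a count of the crossings enters, and the cancellation across sides
    is proved without knowing which two faces share a side. A face is a counterclockwise list of
    corners, and all that is recorded about adjacency is a flux identity: every antisymmetric
    function of directed sides has the same total over all faces as over the outer polygon. It
    survives each cut, since subdividing sides turns an antisymmetric function into another one and
    every new chord appears in both directions. It yields the cancellation of the signs, the
    presence of the n outer sides, and the fact that a new diagonal cuts a face at each of its ends.
    The crossings drop out of the bookkeeping because the quantity followed is the sum of 3(4 - |P|)
    minus the number of vertex ends of sides: a cut through z corners adds 3z to the first and at
    most 2z to the second, so each diagonal adds at least 2, one for each of its ends. Starting from
    12 - 5n, this gives at least (n - 2)(n - 6) after all n(n - 3)/2 diagonals. *)

Definition orient a b c : R :=
  (b.1 - a.1) * (c.2 - a.2) - (b.2 - a.2) * (c.1 - a.1).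

Definition between (k : R) a b : pt :=
  ((1 - k) * a.1 + k * b.1, (1 - k) * a.2 + k * b.2).

Lemma orient_cycle a b c : orient a b c = orient b c a.
Proof. rewrite /orient; ring. Qed.

Lemma orient_swap a b c : orient b a c = - orient a b c.
Proof. rewrite /orient; ring. Qed.

Lemma orient_swapr a b c : orient a c b = - orient a b c.
Proof. rewrite /orient; ring. Qed.

Lemma orient_aab a b : orient a a b = 0.
Proof. rewrite /orient; ring. Qed.

Lemma orient_aba a b : orient a b a = 0.
Proof. rewrite /orient; ring. Qed.

Lemma orient_baa a b : orient b a a = 0.
Proof. rewrite /orient; ring. Qed.

Lemma orient_between u v k a b :
  orient u v (between k a b) = (1 - k) * orient u v a + k * orient u v b.
Proof. rewrite /orient /between /=; ring. Qed.

(** Four points of the plane have an affine dependence whose coefficients are these triangle areas,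
    and the affine function [orient u v] inherits it. For a convex quadrangle all coefficients are
    positive, which restricts the signs at opposite corners. *)
Lemma orient_quad u v a b c d :
  orient b c d * orient u v a + orient a b d * orient u v c =
  orient a c d * orient u v b + orient a b c * orient u v d.
Proof. rewrite /orient; ring. Qed.

(** Counterclockwise strict convexity, required of all triples in list order and not only of
    consecutive ones: this excludes closed curves that wind around several times. *)
Definition polygon P := [&& (2 < size P)%N & uniq P] /\
  forall a b c, subseq [:: a; b; c] P -> 0 < orient a b c.

Definition sides P := zip P (rot 1 P).

Lemma subseq_catP s A B :
  subseq s (A ++ B) ->
  exists t1 t2, [/\ s = t1 ++ t2, subseq t1 A & subseq t2 B].
Proof.
case/subseqP=> m sz ->.
exists (mask (take (size A) m) A), (mask (drop (size A) m) B).
have szA : size (take (size A) m) = size A by rewrite size_takel // sz size_cat leq_addr.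
by rewrite -mask_cat // cat_take_drop !mask_subseq.
Qed.

Lemma polygon_rot k P : polygon P -> polygon (rot k P).
Proof.
case=> sz h; split; first by rewrite size_rot rot_uniq.
move=> a b c; rewrite /rot => /subseq_catP[t1] [t2] [e h1 h2].
have h' : subseq (t2 ++ t1) P by rewrite -(cat_take_drop k P) cat_subseq.
case: t1 e h1 h' => [|a' [|b' [|c' [|? ?]]]] //=.
- by move=> <- _; rewrite cats0; apply: h.
- by move=> [-> <-] _ /h; rewrite -orient_cycle.
- by move=> [-> -> <-] _ /h; rewrite orient_cycle.
- by move=> [-> -> -> <-] _ /h.
Qed.

Lemma polygon_size P : polygon P -> (2 < size P)%N.
Proof. by case=> /andP[]. Qed.

Lemma polygon_uniq P : polygon P -> uniq P.
Proof. by case=> /andP[]. Qed.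

Lemma polygon_catC A B : polygon (A ++ B) -> polygon (B ++ A).
Proof. by move=> /(polygon_rot (size A)); rewrite rot_size_cat. Qed.

Lemma zip_rot1 (s t : seq pt) : size s = size t ->
  zip (rot 1 s) (rot 1 t) = rot 1 (zip s t).
Proof.
by case: s t => [|a s] [|b t] //= [e]; rewrite !rot1_cons zip_rcons.
Qed.

Lemma sides_rot1 P : sides (rot 1 P) = rot 1 (sides P).
Proof. by rewrite /sides zip_rot1 ?size_rot. Qed.

Lemma perm_sides_rot k P : perm_eq (sides (rot k P)) (sides P).
Proof.
elim: k => [|k IH]; first by rewrite rot0.
have [kP|Pk] := ltnP k (size P); last by rewrite rot_oversize // leqW.
by rewrite rotS // sides_rot1 perm_rot.
Qed.

Lemma size_sides P : size (sides P) = size P.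
Proof. by rewrite size_zip size_rot minnn. Qed.

Lemma map_fst_sides P : map fst (sides P) = P.
Proof. by rewrite -/(unzip1 _) unzip1_zip ?size_rot. Qed.

Lemma map_snd_sides P : map snd (sides P) = rot 1 P.
Proof. by rewrite -/(unzip2 _) unzip2_zip ?size_rot. Qed.

Lemma mem_sides P a b : (a, b) \in sides P -> a \in P /\ b \in P.
Proof.
move=> h; split; first by rewrite -(map_fst_sides P); apply: (map_f fst h).
by have := map_f snd h; rewrite map_snd_sides mem_rot.
Qed.

Definition links s := zip s (behead s).

Lemma links_cat s x t : links (s ++ x :: t) = links (rcons s x) ++ links (x :: t).
Proof. by elim: s => [|a [|b s] IH] //=; rewrite /links /= in IH *; rewrite IH. Qed.

Lemma links_rcons2 s x y : links (rcons (rcons s x) y) = rcons (links (rcons s x)) (x, y).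
Proof. by rewrite -[rcons (rcons s x) y]cats1 cat_rcons links_cat cats1. Qed.

Lemma sides_cons x t : sides (x :: t) = links (x :: rcons t x).
Proof.
rewrite /sides rot1_cons /links [behead _]/=.
suff H s1 s2 z : size s1 = size s2 -> zip s1 s2 = zip (rcons s1 z) s2 by apply: H; rewrite size_rcons.
by elim: s1 s2 => [|? s1 IH] [|? s2] //= [/IH->].
Qed.

Lemma convex_comb_gt0 (w x y : R) : 0 < w -> w <= 1 -> 0 <= x -> 0 < y ->
  0 < (1 - w) * x + w * y.
Proof.
move=> w0 w1 x0 y0; have := mulr_gt0 w0 y0.
by have : 0 <= (1 - w) * x by [rewrite mulr_ge0 // subr_ge0]; lra.
Qed.

Section Cut.
Variables u v : pt.
Let l x := orient u v x.

(* Where the line through [u] and [v] meets the line through [a] and [b]; equal to [a] if [l a = l b],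
   since division by [0] gives [0]. *)
Definition inter a b : pt := between (l a / (l a - l b)) a b.

(** Only a strict sign change subdivides a side; a line through an endpoint leaves it whole, so that
    no degenerate side arises. *)
Definition split_side (e : pt * pt) :=
  if l e.1 * l e.2 < 0 then [:: (e.1, inter e.1 e.2); (inter e.1 e.2, e.2)]
  else [:: e].

Lemma l_inter a b : l a != l b -> l (inter a b) = 0.
Proof.
rewrite -subr_eq0 => h; rewrite /l orient_between -/(l a) -/(l b).
by field.
Qed.

Lemma between0 a b : between 0 a b = a.
Proof. by case: a => a1 a2; rewrite /between subr0 !mul1r !mul0r !addr0. Qed.

Lemma between1 a b : between 1 a b = b.
Proof. by case: b => b1 b2; rewrite /between subrr !mul1r !mul0r !add0r. Qed.

Lemma inter0l a b : l a = 0 -> inter a b = a.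
Proof. by move=> h; rewrite /inter h mul0r between0. Qed.

Lemma inter0r a b : l a != 0 -> l b = 0 -> inter a b = b.
Proof. by move=> h0 h; rewrite /inter h subr0 divff // between1. Qed.

Lemma betweenC k a b : between k a b = between (1 - k) b a.
Proof. by rewrite /between; congr pair; ring. Qed.

Lemma interC a b : l a != l b -> inter a b = inter b a.
Proof.
move=> h; rewrite /inter betweenC; congr between; field.
by rewrite !subr_eq0 h eq_sym h.
Qed.

Lemma inter_weight a b : l a > 0 -> l b <= 0 ->
  0 < l a / (l a - l b) /\ l a / (l a - l b) <= 1.
Proof.
move=> ha hb; have h : 0 < l a - l b by lra.
by rewrite divr_gt0 // ler_pdivrMr // mul1r; split => //; lra.
Qed.

Lemma inter_weight1 a b : l a > 0 -> l b < 0 -> l a / (l a - l b) < 1.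
Proof.
by move=> ha hb; rewrite ltr_pdivrMr ?mul1r; lra.
Qed.

End Cut.

Lemma line_between u v q : u != v -> orient u v q = 0 ->
  exists k, q = between k u v.
Proof.
case: u v q => [u1 u2] [v1 v2] [q1 q2]; rewrite /orient /between /= => uv h.
have [e1|n1] := eqVneq u1 v1; last first.
  have n1' : v1 - u1 != 0 by rewrite subr_eq0 eq_sym.
  exists ((q1 - u1) / (v1 - u1)); congr pair; first by field.
  apply: (mulIf n1'); transitivity ((v1 - u1) * u2 + (q1 - u1) * (v2 - u2)); last by field.
  lra.
have n2' : v2 - u2 != 0.
  by rewrite subr_eq0; apply: contraNneq uv => ->; rewrite e1.
exists ((q2 - u2) / (v2 - u2)); congr pair; last by field.
apply: (mulIf n2'); transitivity ((v2 - u2) * u1 + (q2 - u2) * (v1 - u1)); last by field.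
lra.
Qed.

(* Along the line through [u] and [v], the function [orient a c _] is affine
   with slope [orient u v a - orient u v c]. *)
Lemma orient_chord u v a c q1 q2 : u != v ->
  orient u v q1 = 0 -> orient u v q2 = 0 -> orient a c q1 = 0 ->
  orient u v a > 0 -> orient u v c <= 0 -> orient a c q2 > 0 ->
  forall x, orient u v x > 0 -> orient x q1 q2 > 0.
Proof.
move=> uv /(line_between uv)[k1 ->] /(line_between uv)[k2 ->] e ha hc h x hx.
have e1 : orient a c (between k2 u v) - orient a c (between k1 u v) =
  (k2 - k1) * (orient u v a - orient u v c) by rewrite /orient /between /=; ring.
have -> : orient x (between k1 u v) (between k2 u v) = (k2 - k1) * orient u v x.
  by rewrite /orient /between /=; ring.
rewrite mulr_gt0 //; move: e1; rewrite e subr0 => e1.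
by move: h; rewrite e1 pmulr_lgt0 //; lra.
Qed.

Section HalfCut.
Variables (u v : pt) (A C : seq pt).
Hypotheses (uv : u != v) (pol : polygon (A ++ C)) (hA : {in A, forall x, orient u v x > 0})
  (hC : {in C, forall x, orient u v x <= 0}).
Variables a2 a1 c1 c2 : pt.
Hypotheses (A1 : exists A', A = rcons A' a1) (A2 : exists A', A = a2 :: A').
Hypotheses (C1 : exists C', C = c1 :: C') (C2 : exists C', C = rcons C' c2).
Hypothesis Cneg : has (fun x => orient u v x < 0) C.

Let q1 := inter u v a1 c1.
Let q2 := inter u v c2 a2.

(** Triples inside [A] are inherited, and those with one new corner are convex combinations of
    values at corners of [A ++ C]. For [(a, q1, q2)], [orient_chord] reduces all [a] at once to
    [orient a1 c1 q2 > 0]. *)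
Lemma polygon_halfcut : polygon (A ++ [:: q1; q2]).
Proof.
have [_ tri] := pol.
have [A' eA] := A1; have [A'' eA'] := A2; have [C' eC] := C1; have [C'' eC'] := C2.
have a1A : a1 \in A by rewrite eA mem_rcons mem_head.
have a2A : a2 \in A by rewrite eA' mem_head.
have c1C : c1 \in C by rewrite eC mem_head.
have c2C : c2 \in C by rewrite eC' mem_rcons mem_head.
have la1 := hA a1A; have la2 := hA a2A; have lc1 := hC c1C; have lc2 := hC c2C.
have n1 : orient u v a1 != orient u v c1 by rewrite gt_eqF // (le_lt_trans lc1).
have n2 : orient u v c2 != orient u v a2 by rewrite lt_eqF // (le_lt_trans lc2).
have lq1 : orient u v q1 = 0 by apply: l_inter.
have lq2 : orient u v q2 = 0 by apply: l_inter.
have [w1 w1'] := inter_weight la1 lc1; have [w2 w2'] := inter_weight la2 lc2.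
have eq2 : q2 = inter u v a2 c2 by apply: interC.
have triAC a b c : subseq [:: a; b] A -> c \in C -> 0 < orient a b c.
  by move=> s cC; apply: tri; rewrite -[[:: a; b; c]]/([:: a; b] ++ [:: c]) cat_subseq ?sub1seq.
have triACC a b c : a \in A -> subseq [:: b; c] C -> 0 < orient a b c.
  by move=> aA s; apply: tri; rewrite -[[:: a; b; c]]/([:: a] ++ [:: b; c]) cat_subseq ?sub1seq.
have h1 : orient a1 c1 q2 > 0.
  rewrite eq2 /inter orient_between; set w := _ / _ in w2 w2' *.
  have t1 : 0 <= orient a1 c1 a2.
    have [->|n] := eqVneq a1 a2; first by rewrite orient_aba.
    rewrite ltW // -orient_cycle; apply: triAC => //.
    by rewrite eA' /= eqxx sub1seq; move: a1A; rewrite eA' inE (negPf n).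
  (* If [c1 = c2], then [C] is a single corner, strictly negative by [Cneg], and [A] has at least
     two corners; positivity then comes from the weight of [a2]. *)
  have [e|n] := eqVneq c1 c2.
    have n : a1 != a2.
      apply/eqP => ea; move: (polygon_size pol); rewrite size_cat eA' eC' /= size_rcons.
      have eA0 : A'' = [::].
        have : uniq A by move: (polygon_uniq pol); rewrite cat_uniq => /andP[].
        rewrite eA'; move: eA; rewrite eA' -ea.
        by case: A' => [[->]|? A3 [_ ->]] //=; rewrite mem_rcons mem_head.
      have eC0 : C'' = [::].
        have : uniq C by move: (polygon_uniq pol); rewrite cat_uniq => /and3P[].
        rewrite eC; move: eC'; rewrite eC -e.
        by case: C'' => [|x C3 [_ ->]] //=; rewrite mem_rcons mem_head.
      by rewrite eA0 eC0.
    have t1' : 0 < orient a1 c1 a2.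
      rewrite -orient_cycle; apply: triAC => //.
      by rewrite eA' /= eqxx sub1seq; move: a1A; rewrite eA' inE (negPf n).
    have lc2' : orient u v c2 < 0.
      case/hasP: Cneg => c; rewrite eC' mem_rcons inE => /orP[/eqP-> //|cC] lc.
      have : uniq C by move: (polygon_uniq pol); rewrite cat_uniq => /and3P[].
      rewrite eC; move: eC'; rewrite eC -e.
      by case: C'' cC => // x C3 _ [_ ->] /=; rewrite mem_rcons mem_head.
    have w2'' : w < 1 by apply: inter_weight1.
    by rewrite e orient_baa mulr0 addr0 -e mulr_gt0 // subr_gt0.
  have t2 : 0 < orient a1 c1 c2.
    apply: triACC => //.
    by rewrite eC /= eqxx sub1seq; move: c2C; rewrite eC inE eq_sym (negPf n).
  exact: convex_comb_gt0.
have h2 a : a \in A -> orient a q1 q2 > 0.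
  move=> aA; apply: (orient_chord uv lq1 lq2 _ la1 lc1 h1 (hA aA)).
  by rewrite /q1 /inter orient_between orient_aba orient_baa !mulr0 addr0.
have q12 : q1 != q2.
  by apply/eqP => e; move: (h2 _ a1A); rewrite e orient_baa ltxx.
split.
  have szA : (0 < size A)%N by rewrite eA'.
  rewrite size_cat addn2 !ltnS szA cat_uniq /= inE q12.
  move: (polygon_uniq pol); rewrite cat_uniq => /and3P[-> _ _] /=; rewrite orbF andbT negb_or.
  by apply/andP; split; apply/negP => /hA; rewrite ?lq1 ?lq2 ltxx.
move=> a b c /subseq_catP[t1] [t2] [e st1 st2].
have t2s : (size t2 <= 2)%N by rewrite (size_subseq st2).
have q1pos : subseq [:: a; b] A -> orient a b q1 > 0.
  move=> s; have abc := triAC a b c1 s c1C.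
  rewrite /q1 /inter orient_between; set w := _ / _ in w1 w1' *.
  apply: convex_comb_gt0 => //.
  have [->|n] := eqVneq b a1; first by rewrite orient_baa.
  rewrite ltW //; apply: tri; apply: subseq_trans (prefix_subseq _ _).
  move: s; rewrite eA -!cats1 => /subseq_catP[[|x [|y [|? ?]]]] [s2] [] //.
  - by move=> e2 _ s; have := size_subseq s; rewrite -[s2]/([::] ++ s2) -e2.
  - by case=> _ <- _; rewrite sub1seq inE (negPf n).
  - by case=> <- <- _ s _; rewrite -[[:: a; b; a1]]/([:: a; b] ++ [:: a1]) cat_subseq.
have q2pos : subseq [:: a; b] A -> orient a b q2 > 0.
  move=> s; have abc := triAC a b c2 s c2C.
  rewrite eq2 /inter orient_between; set w := _ / _ in w2 w2' *.
  apply: convex_comb_gt0 => //.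
  have [->|n] := eqVneq a a2; first by rewrite orient_aba.
  rewrite ltW // -orient_cycle; apply: tri; apply: subseq_trans (prefix_subseq _ _).
  by move: s; rewrite eA' /= (negPf n) eqxx.
case: t1 e st1 => [|a' [|b' [|c' [|? ?]]]] //.
- by move=> e; move: t2s; rewrite -[t2]/([::] ++ t2) -e.
- case=> -> e2; move: st2; rewrite -e2 => st2 aA.
  have [-> ->] : b = q1 /\ c = q2.
    by case/subseqP: st2 => [[|[] [|[] [|]]]] //= _ [].
  by apply: h2; rewrite sub1seq in aA.
- case=> <- <- e2; move: st2; rewrite -e2 sub1seq !inE => /orP[] /eqP-> s.
    exact: q1pos.
  exact: q2pos.
- by case=> -> -> -> _ s; apply: tri; apply: subseq_trans s (prefix_subseq _ _).
Qed.
End HalfCut.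

Lemma split_first (p : pred pt) s : has p s ->
  exists s1 x s2, [/\ s = s1 ++ x :: s2, all (predC p) s1 & p x].
Proof.
elim: s => //= a s IH; case pa: (p a) => /=; first by move=> _; exists [::], a, s.
by move=> /IH[s1 [x [s2 [-> h px]]]]; exists (a :: s1), x, s2; rewrite /= pa.
Qed.

Lemma split_last (p : pred pt) s : has p s ->
  exists s1 x s2, [/\ s = s1 ++ x :: s2, p x & all (predC p) s2].
Proof.
rewrite -has_rev => /split_first[s1 [x [s2 [e h px]]]].
exists (rev s2), x, (rev s1); rewrite all_rev; split=> //.
by rewrite -[s]revK e rev_cat rev_cons cat_rcons.
Qed.

Lemma polygon_quad P a b c d : polygon P -> subseq [:: a; b; c; d] P ->
  [/\ 0 < orient b c d, 0 < orient a b d, 0 < orient a c d & 0 < orient a b c].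
Proof.
move=> [_ tri] s; split; apply: tri; apply: subseq_trans s.
- exact: subseq_cons.
- rewrite -[[:: a; b; d]]/([:: a; b] ++ [:: d]) -[[:: a; b; c; d]]/([:: a; b] ++ [:: c; d]).
  exact/cat_subseq/subseq_cons.
- rewrite -[[:: a; c; d]]/([:: a] ++ [:: c; d]) -[[:: a; b; c; d]]/([:: a] ++ [:: b; c; d]).
  exact/cat_subseq/subseq_cons.
- by rewrite -[[:: a; b; c; d]]/([:: a; b; c] ++ [:: d]) prefix_subseq.
Qed.

Lemma subseq_mem2 (a b : pt) s t : a \in s -> b \in t -> subseq [:: a; b] (s ++ t).
Proof. by move=> ha hb; rewrite -[[:: a; b]]/([:: a] ++ [:: b]) cat_subseq ?sub1seq. Qed.

Section SignChanges.
Variables (u v : pt) (P : seq pt).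
Let l x := orient u v x.

(* By [orient_quad], the signs +, -, +, - cannot occur in this cyclic order. *)
Lemma sign_split : polygon P -> has (fun x => 0 < l x) P -> has (fun x => l x < 0) P ->
  exists k A Z1 B Z2, [/\ rot k P = A ++ Z1 ++ B ++ Z2,
    {in A, forall x, 0 < l x} /\ {in B, forall x, l x < 0},
    {in Z1, forall x, l x = 0} /\ {in Z2, forall x, l x = 0},
    (size Z1 <= 1)%N /\ (size Z2 <= 1)%N &
    (0 < size A)%N /\ (0 < size B)%N].
Proof.
move=> pol hpos /hasP[x xP lx].
have [i t e] := rot_to xP.
have poli : polygon (x :: t) by rewrite -e; apply: polygon_rot.
have : has (fun x => 0 < l x) t.
  have : has (fun x => 0 < l x) (x :: t) by rewrite -e has_rot.
  by rewrite /= ltNge ltW.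
case/split_first=> t1 [y [t2 [et ht1 ly]]].
(* Read cyclically from the first positive corner [y] after the negative corner [x]: the positive
   run starts the list, and everything after [x] is nonpositive. *)
have polQ : polygon (y :: t2 ++ x :: t1).
  by rewrite -cat_cons; apply: polygon_catC; rewrite cat_cons -et.
have [A' [C' [et2 hA' hC']]] : exists A' C', [/\ t2 = A' ++ C', {in A', forall a, 0 < l a} &
    {in C', forall c, l c <= 0}].
  have [h|/hasPn h] := boolP (has (fun a => l a <= 0) t2); last first.
    by exists t2, [::]; rewrite cats0; split=> // a /h; rewrite -ltNge.
  have [A' [h' [r [er hA' lh]]]] := split_first h.
  exists A', (h' :: r); split=> //.
    by move=> a /(allP hA') /=; rewrite -ltNge.
  move=> c; rewrite inE => /orP[/eqP->//|cr]; rewrite leNgt; apply/negP => lc.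
  (* The signs at [y], [h'], [c], [x] would be +, <= 0, +, -, so that the two sides of [orient_quad]
     have opposite signs. *)
  have sub : subseq [:: y; h'; c; x] (y :: t2 ++ x :: t1).
    rewrite er -catA /= eqxx; apply: subseq_trans (suffix_subseq _ _).
    by rewrite /= eqxx subseq_mem2 // mem_head.
  have [ o1 o2 o3 o4] := polygon_quad polQ sub.
  have := orient_quad u v y h' c x; rewrite -!/(l _) => E.
  have := mulr_gt0 o1 ly; have := mulr_gt0 o2 lc.
  by have := mulr_ge0_le0 (ltW o3) lh; have := mulr_ge0_le0 (ltW o4) (ltW lx); lra.
have hC : {in C' ++ x :: t1, forall c, l c <= 0}.
  move=> c; rewrite mem_cat inE => /or3P[/hC'//|/eqP->|/(allP ht1)/=]; first exact: ltW.
  by rewrite -leNgt.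
have : has (fun c => l c < 0) (C' ++ x :: t1) by rewrite has_cat /= lx orbT.
case/split_first=> Z1 [b [D [eD hZ1 lb]]].
have : has (fun c => l c < 0) (b :: D) by rewrite /= lb.
case/split_last=> B' [b' [Z2 [eB lb' hZ2]]].
have eQ : y :: t2 ++ x :: t1 = (y :: A') ++ Z1 ++ rcons B' b' ++ Z2.
  by rewrite et2 -catA eD eB cat_rcons.
have yA : y \in y :: A' by rewrite mem_head.
have hZ1' : {in Z1, forall z, l z = 0}.
  move=> z zZ; apply/eqP; rewrite eq_le hC /=; last by rewrite eD mem_cat zZ.
  by rewrite leNgt; apply: (allP hZ1).
have hZ2' : {in Z2, forall z, l z = 0}.
  move=> z zZ; apply/eqP; rewrite eq_le hC /=.
    by rewrite leNgt; apply: (allP hZ2).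
  by rewrite eD eB !(mem_cat, inE) zZ !orbT.
have quad a c d : subseq [:: a; c; d] (Z1 ++ rcons B' b' ++ Z2) ->
    [/\ 0 < orient a c d, 0 < orient y a d, 0 < orient y c d & 0 < orient y a c].
  move=> s; apply: (polygon_quad polQ); rewrite eQ.
  by rewrite -[[:: y; a; c; d]]/([:: y] ++ [:: a; c; d]) cat_subseq ?sub1seq.
have ZB : {in rcons B' b' , forall z, z \in b :: D}.
  by move=> z zB; rewrite eB -cat_rcons mem_cat zB.
have hB0 : {in rcons B' b', forall z, l z <= 0}.
  by move=> z zB; rewrite hC // eD mem_cat ZB ?orbT.
have [B0 eB0] : exists B0, rcons B' b' = b :: B0.
  by case: B' eB {quad eQ ZB hB0} => [|? B'] /= [-> _]; [exists [::] | exists (rcons B' b')].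
(* A zero [z] strictly between the negative corners [b] and [b'], with the positive [y] opposite to
   it, again contradicts [orient_quad]. *)
have hB : {in rcons B' b', forall z, l z < 0}.
  move=> z; rewrite mem_rcons inE => /orP[/eqP->//|zB'].
  rewrite lt_neqAle hB0 ?mem_rcons ?inE ?zB' ?orbT // andbT; apply/negP => /eqP lz.
  have nzb : z != b by apply/eqP => ezb; move: lb; rewrite -ezb lz ltxx.
  have : subseq [:: b; z; b'] (Z1 ++ rcons B' b' ++ Z2).
    apply: subseq_trans (suffix_subseq _ _); apply: subseq_trans (prefix_subseq _ _).
    case: B' zB' eB0 {eB eQ ZB hB0 quad} => //= c B'; rewrite inE => zB' [ec _].
    by rewrite ec eqxx -cats1 subseq_mem2 ?mem_head //; move: zB'; rewrite ec (negPf nzb).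
  case/quad=> o1 o2 o3 o4.
  have := orient_quad u v y b z b'; rewrite -!/(l _) lz mulr0 addr0 => E.
  have := mulr_gt0 o1 ly; move: E; rewrite -(opprK (l b)) -(opprK (l b')).
  have := mulr_gt0 o3 (_ : 0 < - l b); have := mulr_gt0 o4 (_ : 0 < - l b').
  by rewrite !oppr_gt0 => /(_ lb') h1 /(_ lb) h2; lra.
have szle1 (Z : seq pt) : uniq Z ->
    (forall z z', subseq [:: z; z'] Z -> False) -> (size Z <= 1)%N.
  by case: Z => [|z [|z' Z]] //= _ /(_ z z'); rewrite !eqxx sub0seq => h; case: h.
have unQ : uniq (Z1 ++ rcons B' b' ++ Z2).
  by move: (polygon_uniq polQ); rewrite eQ cat_uniq => /and3P[].
exists (rot_add P i (size t1).+1), (y :: A'), Z1, (rcons B' b'), Z2; split=> //.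
- by rewrite -rot_rot_add e et -eQ; exact: (rot_size_cat (x :: t1)).
- by split=> // a; rewrite inE => /orP[/eqP->//|/hA'].
- split; apply: szle1; first by move: unQ; rewrite cat_uniq => /andP[].
  + move=> z z' s.
    have zZ : z \in Z1 by apply: (mem_subseq s); rewrite mem_head.
    have zZ' : z' \in Z1 by apply: (mem_subseq s); rewrite !inE eqxx orbT.
    have : subseq [:: z; z'; b'] (Z1 ++ rcons B' b' ++ Z2).
      rewrite -[[:: z; z'; b']]/([:: z; z'] ++ [:: b']) cat_subseq // sub1seq.
      by rewrite mem_cat mem_rcons mem_head.
    case/quad=> o1 o2 o3 o4; have := orient_quad u v y z z' b'.
    rewrite -!/(l _) (hZ1' z zZ) (hZ1' z' zZ') !mulr0 addr0 add0r => E.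
    have := mulr_gt0 o1 ly; have := mulr_gt0 o4 (_ : 0 < - l b').
    by rewrite oppr_gt0 => /(_ lb') h1; lra.
  + by move: unQ; rewrite !cat_uniq => /and3P[_ _ /and3P[]].
  + move=> z z' s.
    have zZ : z \in Z2 by apply: (mem_subseq s); rewrite mem_head.
    have zZ' : z' \in Z2 by apply: (mem_subseq s); rewrite !inE eqxx orbT.
    have : subseq [:: b'; z; z'] (Z1 ++ rcons B' b' ++ Z2).
      apply: subseq_trans (suffix_subseq _ _).
      rewrite -[[:: b'; z; z']]/([:: b'] ++ [:: z; z']) cat_subseq // sub1seq.
      by rewrite mem_rcons mem_head.
    case/quad=> o1 o2 o3 o4; have := orient_quad u v y b' z z'.
    rewrite -!/(l _) (hZ2' z zZ) (hZ2' z' zZ') !mulr0 !addr0 => E.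
    have := mulr_gt0 o1 ly; have := mulr_gt0 o3 (_ : 0 < - l b').
    by rewrite oppr_gt0 => /(_ lb') h1; lra.
- by rewrite size_rcons.
Qed.
End SignChanges.
End Polygons.

(** * Cutting a convex polygon along a line *)

Section PolygonCut.
Local Open Scope ring_scope.
Variable R : realFieldType.
Notation pt := (R * R)%type.
Implicit Types (a b c d p q u v x y : pt) (P A B C s t : seq pt).

(** All that later arguments need about the corners of a part: such points stay in every half-plane
    that contains [P], and a new one is interior to a segment, hence no extreme point of a
    surrounding polygon. *)
Definition cut_point P x := x \in P \/
  exists a b k, [/\ a \in P, b \in P, a != b, 0 < k < 1 & x = between k a b].

Section Cut2.
Variables u v : pt.
Hypothesis uv : u != v.
Let l x := orient u v x.

Lemma split_side_nneg A : {in A, forall x, 0 <= l x} ->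
  flatten (map (split_side u v) (links A)) = links A.
Proof.
elim: A => [|a [|b A] IH] //= h; rewrite /links /= {1}/split_side /=.
rewrite ltNge mulr_ge0 ?h ?mem_head ?(inE, eqxx, orbT) //=.
by congr cons; apply: IH => x hx; apply: h; rewrite inE hx orbT.
Qed.

Lemma split_side_npos A : {in A, forall x, l x <= 0} ->
  flatten (map (split_side u v) (links A)) = links A.
Proof.
elim: A => [|a [|b A] IH] //= h; rewrite /links /= {1}/split_side /=.
rewrite ltNge -mulrNN mulr_ge0 ?oppr_ge0 ?h ?mem_head ?(inE, eqxx, orbT) //=.
by congr cons; apply: IH => x hx; apply: h; rewrite inE hx orbT.
Qed.

(** Both parts come from [polygon_halfcut], the negative one with [u] and [v] exchanged. They have
    |A| + 2 and |B| + 2 corners, where [A] and [B] are the corners strictly on either side; the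
    corners on the line lie in neither, whence the size formula. The only sides that do not come
    from [P] are the two directions of the chord. *)
Lemma polygon_cut P : polygon P ->
  has (fun x => 0 < l x) P -> has (fun x => l x < 0) P ->
  exists P1 P2 q1 q2, [/\
    [/\ polygon P1, polygon P2, {in P1, forall x, 0 <= l x} & {in P2, forall x, l x <= 0}],
    [/\ q1 \in P1, q2 \in P1, q1 != q2, l q1 = 0 & l q2 = 0],
    perm_eq (sides P1 ++ sides P2)
            (flatten (map (split_side u v) (sides P)) ++ [:: (q1, q2); (q2, q1)]),
    (size P1 + size P2 + count (fun x => l x == 0%R) P = size P + 4)%N &
    {in P1, forall x, cut_point P x} /\ {in P2, forall x, cut_point P x}].
Proof.
move=> pol hp hn.
have [k [A [Z1 [B [Z2 [eP [hA hB] [hZ1 hZ2] [sZ1 sZ2] [sA sB]]]]]]] := sign_split pol hp hn.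
have {}hA : {in A, forall x, 0 < l x} := hA.
have {}hB : {in B, forall x, l x < 0} := hB.
have {}hZ1 : {in Z1, forall x, l x = 0} := hZ1.
have {}hZ2 : {in Z2, forall x, l x = 0} := hZ2.
have polk : polygon (A ++ Z1 ++ B ++ Z2) by rewrite -eP; apply: polygon_rot.
have [a2 [A2 eA2]] : exists a2 A2, A = a2 :: A2.
  by case: A sA {eP hA polk} => // a2 A2 _; exists a2, A2.
have [A1 [a1 eA1]] : exists A1 a1, A = rcons A1 a1.
  by case/lastP: A sA {eP hA polk eA2} => // A1 a1 _; exists A1, a1.
have [b1 [B1 eB1]] : exists b1 B1, B = b1 :: B1.
  by case: B sB {eP hB polk} => // b1 B1 _; exists b1, B1.
have [B2 [b2 eB2]] : exists B2 b2, B = rcons B2 b2.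
  by case/lastP: B sB {eP hB polk eB1} => // B2 b2 _; exists B2, b2.
have a1A : a1 \in A by rewrite eA1 mem_rcons mem_head.
have a2A : a2 \in A by rewrite eA2 mem_head.
have b1B : b1 \in B by rewrite eB1 mem_head.
have b2B : b2 \in B by rewrite eB2 mem_rcons mem_head.
have [la1 la2 lb1 lb2] : [/\ 0 < l a1, 0 < l a2, l b1 < 0 & l b2 < 0].
  by split; [exact: hA | exact: hA | exact: hB | exact: hB].
(* [q1] is the corner on the line between the two runs if there is one, and otherwise the crossing
   with the side from [a1] to [b1]; [head] covers both cases, and [last] does the same for [q2]. *)
pose q1 := inter u v a1 (head b1 Z1).
pose q2 := inter u v (last b2 Z2) a2.
have memP x : (x \in P) = [|| x \in A, x \in Z1, x \in B | x \in Z2].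
  by rewrite -(mem_rot k) eP !mem_cat.
have cross a b : a \in P -> b \in P -> 0 < l a -> l b < 0 -> cut_point P (inter u v a b).
  move=> aP bP la lb; right; exists a, b, (l a / (l a - l b)); split=> //.
    by apply: contraTneq la => ->; rewrite -leNgt ltW.
  have [-> _] := inter_weight la (ltW lb).
  by rewrite (inter_weight1 la lb).
have hZ1B : l (head b1 Z1) <= 0.
  by case: Z1 hZ1 {eP polk sZ1 memP q1} => [|z ?] /=; [rewrite ltW | move=> hz; rewrite hz ?mem_head].
have hZ2B : l (last b2 Z2) <= 0.
  case/lastP: Z2 hZ2 {eP polk sZ2 memP q2} => [|Z2 z] h /=; first by rewrite ltW.
  by rewrite last_rcons h // mem_rcons mem_head.
have n1 : l a1 != l (head b1 Z1) by rewrite gt_eqF // (le_lt_trans hZ1B).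
have n2 : l (last b2 Z2) != l a2 by rewrite lt_eqF // (le_lt_trans hZ2B).
have lq1 : l q1 = 0 by apply: l_inter.
have lq2 : l q2 = 0 by apply: l_inter.
have cq1 : cut_point P q1.
  rewrite /q1; case: Z1 hZ1 memP {eP polk sZ1 n1 lq1 hZ1B q1} => [|z Z1] /= hz memP.
    by apply: cross; rewrite ?memP ?a1A ?b1B ?orbT.
  have lz : l z = 0 by rewrite hz ?mem_head.
  by left; rewrite inter0r ?gt_eqF // memP mem_head ?orbT.
have cq2 : cut_point P q2.
  rewrite /q2; case/lastP: Z2 hZ2 memP {eP polk sZ2 n2 lq2 hZ2B q2} => [|Z2 z] hz memP.
    rewrite /= interC; last by rewrite -!/(l _) lt_eqF // (lt_trans lb2).
    by apply: cross; rewrite ?memP ?a2A ?b2B ?orbT.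
  have lz : l z = 0 by rewrite hz ?mem_rcons ?mem_head.
  by left; rewrite last_rcons inter0l // memP mem_rcons mem_head ?orbT.
have eq1 : q1 = inter u v (last a1 Z1) b1.
  rewrite /q1; case: Z1 hZ1 sZ1 {eP polk hZ1B n1 lq1 cq1 memP q1} => [|z [|? ?]] //= hz _.
  have lz : l z = 0 by rewrite hz ?mem_head.
  by rewrite inter0r ?gt_eqF // inter0l.
have eq2 : q2 = inter u v b2 (head a2 Z2).
  rewrite /q2; case: Z2 hZ2 sZ2 {eP polk hZ2B n2 lq2 cq2 memP q2} => [|z [|? ?]] //= hz _.
  have lz : l z = 0 by rewrite hz ?mem_head.
  by rewrite inter0l // inter0r // lt_eqF.
have pol1 : polygon (A ++ [:: q1; q2]).
  apply: (@polygon_halfcut _ u v A (Z1 ++ B ++ Z2)) => //.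
  - by move=> x; rewrite -/(l x) !mem_cat => /or3P[/hZ1->|/hB/ltW|/hZ2->].
  - by exists A1.
  - by exists A2.
  - by rewrite eB1; case: (Z1) => [|z Z1'] /=; [exists (B1 ++ Z2) | exists (Z1' ++ b1 :: B1 ++ Z2)].
  - rewrite eB2; case/lastP: (Z2) => [|Z2' z] /=; first by exists (Z1 ++ B2); rewrite cats0 rcons_cat.
    by exists (Z1 ++ rcons B2 b2 ++ Z2'); rewrite last_rcons !rcons_cat.
  - by rewrite !has_cat; apply/or3P; constructor 2; apply/hasP; exists b1; rewrite // -/(l _).
have ln x : orient v u x = - l x by exact: orient_swap.
have interN a b : l a != l b -> inter v u a b = inter u v a b.
  move=> nab; rewrite /inter !ln; congr between.
  by rewrite -opprD invrN mulrNN.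
have pol2 : polygon (B ++ [:: q2; q1]).
  have -> : q2 = inter v u b2 (head a2 Z2).
    rewrite eq2 interN // -/(l _); apply: contraTneq lb2 => ->; rewrite -leNgt.
    by case: (Z2) hZ2 => [|z ?] /= h; [rewrite ltW | rewrite h ?mem_head].
  have -> : q1 = inter v u (last a1 Z1) b1.
    rewrite eq1 interN // -/(l _); apply: contraTneq lb1 => <-; rewrite -leNgt.
    by case/lastP: (Z1) hZ1 => [|? z] /= h; [rewrite ltW | rewrite last_rcons h // mem_rcons mem_head].
  apply: (@polygon_halfcut _ v u B (Z2 ++ A ++ Z1)) => //.
  - by rewrite eq_sym.
  - by have := polygon_catC (A := A ++ Z1) (B := B ++ Z2); rewrite -!catA; apply.
  - by move=> x /hB; rewrite ln oppr_gt0.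
  - by move=> x; rewrite ln oppr_le0 !mem_cat => /or3P[/hZ2->|/hA/ltW|/hZ1->].
  - by exists B2.
  - by exists B1.
  - by rewrite eA2; case: (Z2) => [|z Z2'] /=; [exists (A2 ++ Z1) | exists (Z2' ++ a2 :: A2 ++ Z1)].
  - rewrite eA1; case/lastP: (Z1) => [|Z1' z] /=; first by exists (Z2 ++ A1); rewrite cats0 rcons_cat.
    by exists (Z2 ++ rcons A1 a1 ++ Z1'); rewrite last_rcons !rcons_cat.
  - by rewrite !has_cat; apply/or3P; constructor 2; apply/hasP; exists a1; rewrite // ln oppr_lt0.
exists (A ++ [:: q1; q2]), (B ++ [:: q2; q1]), q1, q2; split.
- split=> // x; rewrite mem_cat !inE => /or3P[|/eqP->|/eqP->]; rewrite ?lq1 ?lq2 //.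
    by move/hA/ltW.
  by move/hB/ltW.
- split=> //; rewrite ?mem_cat ?inE ?eqxx ?orbT //.
  by move: (polygon_uniq pol1); rewrite cat_uniq /= inE => /and3P[_ _ /andP[]].
- have e1 : sides (A ++ [:: q1; q2]) = links A ++ [:: (a1, q1); (q1, q2); (q2, a2)].
    rewrite [in LHS]eA2 cat_cons sides_cons.
    have -> : a2 :: rcons (A2 ++ [:: q1; q2]) a2 = A1 ++ a1 :: [:: q1; q2; a2].
      by rewrite rcons_cat -cat_cons -eA2 eA1 cat_rcons.
    by rewrite links_cat -eA1.
  have e2 : sides (B ++ [:: q2; q1]) = links B ++ [:: (b2, q2); (q2, q1); (q1, b1)].
    rewrite [in LHS]eB1 cat_cons sides_cons.
    have -> : b1 :: rcons (B1 ++ [:: q2; q1]) b1 = B2 ++ b2 :: [:: q2; q1; b1].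
      by rewrite rcons_cat -cat_cons -eB1 eB2 cat_rcons.
    by rewrite links_cat -eB2.
  have e3 : sides (A ++ Z1 ++ B ++ Z2) = links A ++ links (a1 :: rcons Z1 b1) ++
      links B ++ links (b2 :: rcons Z2 a2).
    rewrite [in LHS]eA2 cat_cons sides_cons.
    have -> : a2 :: rcons (A2 ++ Z1 ++ B ++ Z2) a2 = A1 ++ a1 :: (Z1 ++ B ++ rcons Z2 a2).
      by rewrite !rcons_cat -cat_cons -eA2 eA1 cat_rcons.
    rewrite links_cat -eA1; congr (_ ++ _).
    have -> : a1 :: Z1 ++ B ++ rcons Z2 a2 = (a1 :: Z1) ++ b1 :: (B1 ++ rcons Z2 a2).
      by rewrite eB1.
    rewrite links_cat rcons_cons; congr (_ ++ _).
    have -> : b1 :: B1 ++ rcons Z2 a2 = B2 ++ b2 :: rcons Z2 a2.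
      by rewrite -cat_cons -eB1 eB2 cat_rcons.
    by rewrite links_cat -eB2.
  have h1 : flatten (map (split_side u v) (links (a1 :: rcons Z1 b1))) = [:: (a1, q1); (q1, b1)].
    rewrite /q1; case: Z1 hZ1 sZ1 {eP polk hZ1B n1 lq1 cq1 memP q1 eq1 pol1 pol2 e1 e2 e3}
      => [|z [|? ?]] //= hz _.
      by rewrite /links /= /split_side /= -!/(l _) pmulr_rlt0 // lb1.
    have lz : l z = 0 by rewrite hz ?mem_head.
    by rewrite /links /= /split_side /= -!/(l _) lz mulr0 mul0r ltxx /= inter0r // gt_eqF.
  have h2 : flatten (map (split_side u v) (links (b2 :: rcons Z2 a2))) = [:: (b2, q2); (q2, a2)].
    rewrite /q2; case: Z2 hZ2 sZ2 {eP polk hZ2B n2 lq2 cq2 memP q2 eq2 pol1 pol2 e1 e2 e3}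
      => [|z [|? ?]] //= hz _.
      by rewrite /links /= /split_side /= -!/(l _) pmulr_llt0 // lb2.
    have lz : l z = 0 by rewrite hz ?mem_head.
    by rewrite /links /= /split_side /= -!/(l _) lz mulr0 mul0r ltxx /= inter0l.
  have hP : perm_eq (flatten (map (split_side u v) (sides P)))
      (flatten (map (split_side u v) (sides (A ++ Z1 ++ B ++ Z2)))).
    by apply/perm_flatten/perm_map; rewrite -eP perm_sym perm_sides_rot.
  rewrite perm_sym; apply: perm_trans (perm_cat hP (perm_refl _)) _.
  rewrite e3 !map_cat !flatten_cat h1 h2 e1 e2 split_side_nneg; last by move=> x /hA/ltW.
  rewrite split_side_npos; last by move=> x /hB/ltW.
  apply/permP => f; rewrite !count_cat /=.
  move: (count f _) (count f _) (nat_of_bool (f (a1, q1))) (nat_of_bool (f (q1, b1))).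
  move: (nat_of_bool (f (b2, q2))) (nat_of_bool (f (q2, a2))).
  move: (nat_of_bool (f (q1, q2))) (nat_of_bool (f (q2, q1))).
  by move=> a b c d e f' g h; ring.
- have /permP-> : perm_eq P (rot k P) by rewrite perm_sym perm_rot.
  rewrite -(size_rot k P) eP !size_cat !count_cat /=.
  have -> : count (fun x => l x == 0) A = 0%N.
    by apply/eqP; rewrite -leqn0 leqNgt -has_count; apply/hasPn => x /hA; rewrite lt0r => /andP[].
  have -> : count (fun x => l x == 0) B = 0%N.
    by apply/eqP; rewrite -leqn0 leqNgt -has_count; apply/hasPn => x /hB; rewrite lt_def eq_sym => /andP[].
  have -> : count (fun x => l x == 0) Z1 = size Z1.
    by apply/eqP; rewrite -all_count; apply/allP => x /hZ1->.
  have -> : count (fun x => l x == 0) Z2 = size Z2.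
    by apply/eqP; rewrite -all_count; apply/allP => x /hZ2->.
  by rewrite !add0n; ring.
- split=> x; rewrite mem_cat !inE => /or3P[h|/eqP->|/eqP->] //; left.
    by rewrite memP h.
  by rewrite memP h !orbT.
Qed.
End Cut2.
End PolygonCut.

(** * Corners, sides and chords of a convex polygon *)

Section SidesAndChords.
Local Open Scope ring_scope.
Variable R : realFieldType.
Notation pt := (R * R)%type.
Implicit Types (a b c d p q u v x y : pt) (P A B C s t : seq pt) (F : seq (seq pt)).

Lemma sides_rot k P : sides (rot k P) = rot k (sides P).
Proof.
elim: k => [|k IH]; first by rewrite !rot0.
have [kP|Pk] := ltnP k (size P); last by rewrite !rot_oversize ?size_sides // leqW.
rewrite rotS // sides_rot1 IH.
by rewrite -[in RHS]add1n rotD // add1n size_sides.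
Qed.

Lemma mem_sides_rot k P e : (e \in sides (rot k P)) = (e \in sides P).
Proof. by rewrite sides_rot mem_rot. Qed.

Lemma side_at P a b : polygon P -> (a, b) \in sides P ->
  exists k t, rot k P = a :: b :: t.
Proof.
move=> pol /rot_to[k r]; rewrite -sides_rot => e; exists k.
have := polygon_size (polygon_rot k pol); case: (rot k P) e => [|x [|y t]] //.
by rewrite sides_cons /= => -[<- <- _] _; exists t.
Qed.

Lemma corner_at P x : polygon P -> x \in P ->
  exists k z w y, rot k P = x :: z :: rcons w y.
Proof.
move=> pol /rot_to[k r e]; have := polygon_size (polygon_rot k pol); rewrite e.
case: r e => [|z r] // e; case/lastP: r e => [|w y] // e _.
by exists k, z, w, y.
Qed.

Lemma side_orient P a b c : polygon P -> (a, b) \in sides P -> c \in P ->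
  c != a -> c != b -> 0 < orient a b c.
Proof.
move=> pol ab cP ca cb; have [k [t e]] := side_at pol ab.
have [_] := polygon_rot k pol; rewrite e; apply; rewrite /= !eqxx sub1seq.
by move: cP; rewrite -(mem_rot k P) e !inE (negPf ca) (negPf cb).
Qed.

Lemma side_orient_ge0 P a b c : polygon P -> (a, b) \in sides P -> c \in P ->
  0 <= orient a b c.
Proof.
move=> pol ab cP; have [->|ca] := eqVneq c a; first by rewrite orient_aba.
have [->|cb] := eqVneq c b; first by rewrite orient_baa.
exact/ltW/(side_orient pol ab).
Qed.

Lemma side_neq P a b : polygon P -> (a, b) \in sides P -> a != b.
Proof.
move=> pol ab; have [k [t e]] := side_at pol ab.
have := polygon_uniq (polygon_rot k pol); rewrite e /= inE negb_or.
by case/andP=> /andP[].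
Qed.

Lemma sides_corner x z w y :
  sides (x :: z :: rcons w y) = (x, z) :: rcons (links (z :: rcons w y)) (y, x).
Proof.
rewrite sides_cons; transitivity ((x, z) :: links (rcons (rcons (z :: w) y) x)) => //.
by rewrite links_rcons2.
Qed.

Lemma polygon_corner P x : polygon P -> x \in P ->
  exists y z, [/\ (y, x) \in sides P, (x, z) \in sides P & 0 < orient y x z].
Proof.
move=> pol xP; have [k [z [w [y e]]]] := corner_at pol xP; exists y, z.
have polk := polygon_rot k pol.
rewrite -!(mem_sides_rot k P) e sides_corner inE mem_rcons !mem_head orbT; split=> //.
have [_ h] := polk; rewrite orient_cycle; apply: h; rewrite e /= !eqxx sub1seq.
by rewrite mem_rcons mem_head.
Qed.

Lemma subseq2_or (a b : pt) t : a != b -> a \in t -> b \in t ->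
  subseq [:: a; b] t \/ subseq [:: b; a] t.
Proof.
move=> ab /splitPr[t1 t2]; rewrite mem_cat inE eq_sym (negPf ab) /= => /orP[] bt.
  by right; rewrite subseq_mem2 // mem_head.
left; apply: subseq_trans (suffix_subseq _ _).
by rewrite /= eqxx sub1seq.
Qed.

Lemma polygon_orient_neq0 P x y z : polygon P -> x \in P -> y \in P -> z \in P ->
  x != y -> y != z -> x != z -> orient x y z != 0.
Proof.
move=> pol xP yP zP xy yz xz; case/rot_to: xP => k t e.
have [_ h] := polygon_rot k pol; rewrite e in h.
have memt c : c \in P -> x != c -> c \in t.
  by rewrite -(mem_rot k P) e inE eq_sym => /orP[/eqP->|]; rewrite ?eqxx.
have [s|s] := subseq2_or yz (memt _ yP xy) (memt _ zP xz).
  by rewrite gt_eqF // h // /= eqxx.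
by rewrite -oppr_eq0 -orient_swapr gt_eqF // h // /= eqxx.
Qed.

(** No third corner lies on the line through [x] and [y]. *)
Lemma chord_unique P x y u v : polygon P -> x \in P -> y \in P -> u \in P -> v \in P ->
  x != y -> u != v -> orient x y u = 0 -> orient x y v = 0 ->
  (u, v) = (x, y) \/ (u, v) = (y, x).
Proof.
move=> pol xP yP uP vP xy uv hu hv.
have on w : w \in P -> orient x y w = 0 -> (w == x) || (w == y).
  move=> wP; apply: contra_eqT; rewrite negb_or => /andP[wx wy].
  by apply: (polygon_orient_neq0 pol) => //; rewrite eq_sym.
case/orP: (on u uP hu) uv => /eqP->; case/orP: (on v vP hv) => /eqP->; rewrite ?eqxx //.
  by left.
by right.
Qed.

Lemma lines_meet a b c x : orient a b c != 0 -> orient a b x = 0 -> orient b c x = 0 -> x = b.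
Proof.
case: a b c x => [a1 a2] [b1 b2] [c1 c2] [x1 x2]; rewrite /orient /= => h h1 h2.
congr pair; apply/eqP; rewrite -subr_eq0; apply/eqP/(mulIf h); rewrite mul0r.
  transitivity (((b1 - a1) * (x2 - a2) - (b2 - a2) * (x1 - a1)) * (c1 - b1) -
     ((c1 - b1) * (x2 - b2) - (c2 - b2) * (x1 - b1)) * (b1 - a1)); first by ring.
  by rewrite h1 h2 !mul0r subr0.
transitivity (((b1 - a1) * (x2 - a2) - (b2 - a2) * (x1 - a1)) * (c2 - b2) -
     ((c1 - b1) * (x2 - b2) - (c2 - b2) * (x1 - b1)) * (b2 - a2)); first by ring.
by rewrite h1 h2 !mul0r subr0.
Qed.

(** The closed region as an intersection of half-planes; [convex_hull_polygon] identifies it with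
    the convex hull of the corners. *)
Definition inhull s c := all (fun e => 0 <= orient e.1 e.2 c) (sides s).

Lemma inhullP s c : reflect (forall a b, (a, b) \in sides s -> 0 <= orient a b c) (inhull s c).
Proof.
apply: (iffP allP) => [h a b ab|h [a b] ab].
  exact: (h (a, b) ab).
exact: (h a b ab).
Qed.

Lemma between_inhull s k a b : 0 <= k <= 1 -> inhull s a -> inhull s b ->
  inhull s (between k a b).
Proof.
move=> /andP[k0 k1] /inhullP ha /inhullP hb; apply/inhullP => x y xy.
have := ha _ _ xy; have := hb _ _ xy => h1 h2.
by rewrite orient_between addr_ge0 // mulr_ge0 // subr_ge0.
Qed.

Lemma polygon_inhull s c : polygon s -> c \in s -> inhull s c.
Proof. by move=> pol cs; apply/inhullP => a b ab; apply: (side_orient_ge0 pol). Qed.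

(** If such a point were a corner, the lines of both sides at this corner would contain [a] and [b],
    but they meet in one point only. Hence crossings are never vertices. *)
Lemma polygon_extreme s k a b : polygon s -> inhull s a -> inhull s b -> a != b ->
  0 < k < 1 -> between k a b \notin s.
Proof.
move=> pol /inhullP ha /inhullP hb ab /andP[k0 k1]; apply/negP.
set x := between k a b => xs; have [y [z [yx xz o]]] := polygon_corner pol xs.
have zero p q : orient p q x = 0 -> (p, q) \in sides s -> orient p q a = 0 /\ orient p q b = 0.
  rewrite orient_between => e pq; have := ha _ _ pq; have := hb _ _ pq => h1 h2.
  have k1' : 0 < 1 - k by rewrite subr_gt0.
  have p1 := mulr_ge0 (ltW k1') h2; have p2 := mulr_ge0 (ltW k0) h1.
  have /eqP : (1 - k) * orient p q a = 0 by lra.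
  have /eqP : k * orient p q b = 0 by lra.
  by rewrite !mulf_eq0 (gt_eqF k0) (gt_eqF k1') => /eqP-> /eqP->.
have [yxa yxb] := zero _ _ (orient_baa _ _) yx.
have [xza xzb] := zero _ _ (orient_aba _ _) xz.
have nz : orient y x z != 0 by rewrite gt_eqF.
by move/eqP: ab; apply; rewrite (lines_meet nz yxa xza) (lines_meet nz yxb xzb).
Qed.

Lemma side_separates s x y : polygon s -> x \in s -> y \in s -> x != y ->
  exists p q, [/\ (p, q) \in sides s, orient p q x = 0 & 0 < orient p q y].
Proof.
move=> pol xs ys xy; have [p [q [px xq o]]] := polygon_corner pol xs.
have [e|yq] := eqVneq y q.
  by exists p, x; rewrite orient_baa e.
exists x, q; rewrite orient_aba; split=> //.
by apply: (side_orient pol) => //; rewrite eq_sym.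
Qed.

(** A side line through [x] but not [y] bounds the parameter below by 0, and one through [y] but not
    [x] bounds it above by 1. *)
Lemma inhull_chord s x y c : polygon s -> x \in s -> y \in s -> x != y ->
  inhull s c -> orient x y c = 0 -> exists k, 0 <= k <= 1 /\ c = between k x y.
Proof.
move=> pol xs ys xy /inhullP hc /(line_between xy)[k e]; exists k; split=> //.
have [p [q [pq e1 o1]]] := side_separates pol xs ys xy.
have [|p' [q' [pq' e2 o2]]] := side_separates pol ys xs; first by rewrite eq_sym.
have := hc _ _ pq; have := hc _ _ pq'; rewrite e !orient_between e1 e2 !mulr0 add0r addr0.
by rewrite !pmulr_lge0 // subr_ge0 => -> ->.
Qed.

End SidesAndChords.

(** * Dissections of a polygon by its diagonals *)

(** The excess grows by [3z]. At most [2z] of it pays for the vertex ends of the two copies of the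
    chord ([c] and [d] tell whether its ends are vertices), and the remaining [z] covers the ends of
    the diagonal among the corners ([a] and [b]). *)
Lemma cut_face_count (s p1 p2 z a b c d : nat) :
  (p1 + p2 + z = s + 4)%N -> (a + b <= z)%N -> (c + d <= z)%N ->
  (12 - 3 * s%:Z + (a%:Z + b%:Z) <=
   12 - 3 * p1%:Z + (12 - 3 * p2%:Z + 0) - (c%:Z + d%:Z + (d%:Z + c%:Z + 0)) :> int)%R.
Proof. lia. Qed.

Lemma addr_gain (a b c d e f g h : int) : (b + d <= e - f -> a + c <= g - h ->
  a + b + (c + d) <= g + e - (h + f))%R.
Proof. lia. Qed.

Section FaceCut.
Local Open Scope ring_scope.
Variable R : realFieldType.
Notation pt := (R * R)%type.
Implicit Types (a b c d p q u v x y : pt) (P A B C s t : seq pt) (F : seq (seq pt)).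

Definition allsides F := flatten (map (@sides R) F).

Lemma allsides_cons P F : allsides (P :: F) = sides P ++ allsides F.
Proof. by []. Qed.

Lemma allsides_cat F1 F2 : allsides (F1 ++ F2) = allsides F1 ++ allsides F2.
Proof. by rewrite /allsides map_cat flatten_cat. Qed.

Definition onesided u v P :=
  all (fun x => 0 <= orient u v x) P || all (fun x => orient u v x <= 0) P.

Lemma onesidedPn u v P : ~~ onesided u v P ->
  has (fun x => 0 < orient u v x) P /\ has (fun x => orient u v x < 0) P.
Proof.
rewrite negb_or -!has_predC => /andP[h1 h2].
split; [move: h2|move: h1]; apply: sub_has => x /=; by rewrite -ltNge.
Qed.

Lemma onesidedC u v P : onesided u v P = onesided v u P.
Proof.
by rewrite /onesided orbC; congr orb; apply: eq_all => x;
  rewrite (orient_swap u v) ?oppr_ge0 ?oppr_le0.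
Qed.

Lemma cut_point_onesided u v P P' : {in P', forall x, cut_point P x} ->
  onesided u v P -> onesided u v P'.
Proof.
move=> h /orP[] /allP hP; apply/orP; [left|right]; apply/allP => x /h[/hP //|].
  move=> [a [b [k [/hP ha /hP hb _ /andP[k0 k1] ->]]]].
  by rewrite orient_between addr_ge0 // mulr_ge0 // ?subr_ge0 // ltW.
move=> [a [b [k [/hP ha /hP hb _ /andP[k0 k1] ->]]]].
by rewrite orient_between -oppr_ge0 opprD addr_ge0 // -mulrN mulr_ge0 ?oppr_ge0 // ?subr_ge0 // ltW.
Qed.

Lemma cut_point_inhull s P P' : {in P', forall x, cut_point P x} ->
  {in P, forall x, inhull s x} -> {in P', forall x, inhull s x}.
Proof.
move=> h hP x /h[/hP//|[a [b [k [/hP ha /hP hb _ /andP[k0 k1] ->]]]]].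
by apply: between_inhull => //; rewrite !ltW.
Qed.

Definition both_ways (q : pt * pt) : seq (pt * pt) := [:: q; (q.2, q.1)].

Section Step.
Variables (u v : pt) (V : seq pt).
Hypothesis uv : u != v.
Let l x := orient u v x.

(** A lower bound for what the cut adds to the excess minus the vertex ends at [P]; a face that is
    not cut contributes nothing. *)
Definition gain P : int :=
  if onesided u v P then 0 else (u \in P : nat)%:Z + (v \in P : nat)%:Z.

Definition vertex_ends (e : pt * pt) : int := (e.1 \in V : nat)%:Z + (e.2 \in V : nat)%:Z.

(** The factor 3 in 3(4 - |P|) matches the total sign 3 of a triangle. *)
Definition excess P : int := 12 - 3 * (size P)%:Z.

Lemma count_ge2 (f : pred pt) P a b : a != b ->
  (((a \in P) && f a) + ((b \in P) && f b) <= count f P)%N.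
Proof.
move=> ab; elim: P => //= x P IH; rewrite !inE.
have [ax|nax] := eqVneq a x; have [bx|nbx] := eqVneq b x => /=.
- by move/eqP: ab; rewrite ax bx.
- rewrite -ax; apply: leq_trans (leq_add (leqnn (f a)) IH).
  by case: (f a); case: (a \in P) => //=.
- rewrite -bx; apply: leq_trans (leq_add (leqnn (f b)) IH).
  by case: (f b); case: (b \in P); rewrite /= ?addn0 ?andbF ?addn1 ?add1n // leqW.
- by apply: leq_trans (leq_addl _ _).
Qed.

(** The list [ch] holds the new chord, if there is one. By the hypothesis on [V], an end of the
    chord in [V] was already a corner of [P] on the line, so it is among the [z] corners that the
    size formula counts. *)
Lemma cut_face P : polygon P -> {in V, forall x, cut_point P x -> x \in P} ->
  exists F' (ch : seq (pt * pt)), [/\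
    {in F', forall P', [/\ polygon P', onesided u v P' & {in P', forall x, cut_point P x}]},
    {in ch, forall e, [/\ l e.1 = 0, l e.2 = 0 & e.1 != e.2]},
    perm_eq (allsides F') (flatten (map (split_side u v) (sides P)) ++ flatten (map both_ways ch)) &
    excess P + gain P <=
      \sum_(P' <- F') excess P' - \sum_(e <- flatten (map both_ways ch)) vertex_ends e].
Proof.
move=> pol hV; rewrite /gain; have [ os|nos] := boolP (onesided u v P).
  exists [:: P], [::]; split=> //.
  - by move=> P'; rewrite inE => /eqP->; split=> // x; left.
  - rewrite cats0 /allsides /= cats0.
    have -> : flatten (map (split_side u v) (sides P)) = sides P; last exact: perm_refl.
    case: P {pol hV} os => // x t; rewrite sides_cons => /orP[] /allP h.
      by rewrite split_side_nneg // => y yP; apply: h; move: yP; rewrite !inE mem_rcons inE orbA orbb.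
    by rewrite split_side_npos // => y yP; apply: h; move: yP; rewrite !inE mem_rcons inE orbA orbb.
  - by rewrite big_seq1 /= big_nil; lia.
have [hp hn] := onesidedPn nos.
have [P1 [P2 [q1 [q2 [[pol1 pol2 h1 h2] [q1P q2P q12 lq1 lq2] pe sz [c1 c2]]]]]] :=
  polygon_cut uv pol hp hn.
exists [:: P1; P2], [:: (q1, q2)]; split=> //.
- move=> P'; rewrite !inE => /orP[] /eqP->; split=> //; apply/orP; [left|right]; exact/allP.
- by move=> q; rewrite inE => /eqP->.
- by rewrite /allsides /= cats0.
rewrite !big_cons !big_nil /vertex_ends /excess /=.
set z := count _ _ in sz.
have z1 : ((u \in P) + (v \in P) <= z)%N.
  have := count_ge2 (fun x => l x == 0) P uv.
  by rewrite /l orient_aba orient_baa eqxx !andbT.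
have inP q : q \in P1 -> q \in V -> q \in P by move=> qP qV; apply: hV => //; apply: c1.
have z2 : ((q1 \in V) + (q2 \in V) <= z)%N.
  apply: leq_trans (count_ge2 (fun x => l x == 0) P q12).
  rewrite /l lq1 lq2 eqxx !andbT; apply: leq_add.
    by case: (boolP (q1 \in V)) => // /inP->.
  by case: (boolP (q2 \in V)) => // /inP->.
exact: (cut_face_count sz z1 z2).
Qed.

Lemma cut_faces F : {in F, forall P, polygon P} ->
  {in F, forall P, {in V, forall x, cut_point P x -> x \in P}} ->
  exists F' (ch : seq (pt * pt)), [/\
    {in F', forall P', [/\ polygon P', onesided u v P' &
       exists2 P, P \in F & {in P', forall x, cut_point P x}]},
    {in ch, forall e, [/\ l e.1 = 0, l e.2 = 0 & e.1 != e.2]},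
    perm_eq (allsides F')
      (flatten (map (split_side u v) (allsides F)) ++ flatten (map both_ways ch)) &
    \sum_(P <- F) excess P + \sum_(P <- F) gain P <=
      \sum_(P' <- F') excess P' - \sum_(e <- flatten (map both_ways ch)) vertex_ends e].
Proof.
elim: F => [|P F IH] hF hV.
  by exists [::], [::]; split=> //; rewrite !big_nil.
have [||F1 [ch1 [a1 b1 c1 d1]]] := IH.
- by move=> Q QF; apply: hF; rewrite inE QF orbT.
- by move=> Q QF; apply: hV; rewrite inE QF orbT.
have [||F2 [ch2 [a2 b2 c2 d2]]] := @cut_face P.
- by apply: hF; rewrite mem_head.
- by apply: hV; rewrite mem_head.
exists (F2 ++ F1), (ch2 ++ ch1); split.
- move=> Q; rewrite mem_cat => /orP[/a2[]|/a1[pQ oQ [P' P'F h]]].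
    by move=> *; split=> //; exists P => //; rewrite mem_head.
  by split=> //; exists P' => //; rewrite inE P'F orbT.
- by move=> q; rewrite mem_cat => /orP[/b2|/b1].
- rewrite allsides_cat allsides_cons !map_cat !flatten_cat.
  apply: perm_trans (perm_cat c2 c1) _; rewrite -!catA perm_cat2l.
  by rewrite !catA perm_cat2r perm_catC.
- rewrite map_cat flatten_cat !big_cat !big_cons /=.
  exact: (addr_gain d1 d2).
Qed.
End Step.
End FaceCut.

(** * Sums of antisymmetric functions over directed sides *)

Section Flux.
Local Open Scope ring_scope.
Variable R : realFieldType.
Notation pt := (R * R)%type.
Implicit Types (a b c d p q u v x y : pt) (P A B C s t : seq pt) (F : seq (seq pt)).

Definition flux (g : pt -> pt -> int) (E : seq (pt * pt)) : int := \sum_(e <- E) g e.1 e.2.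

Definition antisym (g : pt -> pt -> int) := forall a b, g b a = - g a b.

Lemma flux_perm g E1 E2 : perm_eq E1 E2 -> flux g E1 = flux g E2.
Proof. exact: perm_big. Qed.

Lemma flux_cat g E1 E2 : flux g (E1 ++ E2) = flux g E1 + flux g E2.
Proof. exact: big_cat. Qed.

Lemma flux_both_ways g (E : seq (pt * pt)) : antisym g ->
  flux g (flatten (map (@both_ways R) E)) = 0.
Proof.
move=> h; elim: E => [|e E IH]; first by rewrite /flux big_nil.
rewrite /= -[_ :: _]/(both_ways e ++ flatten (map (@both_ways R) E)) flux_cat IH addr0.
by rewrite /flux /both_ways !big_cons big_nil /= h addr0 addNr.
Qed.

Lemma flux_split g u v (E : seq (pt * pt)) :
  flux g (flatten (map (split_side u v) E)) =
  flux (fun a b => flux g (split_side u v (a, b))) E.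
Proof.
elim: E => [|[a b] E IH]; first by rewrite /flux !big_nil.
rewrite [flatten _]/= flux_cat IH.
by rewrite {4}/flux big_cons.
Qed.

(** Cutting replaces [g] on the old sides by this function. The flux identity must therefore be
    carried along for all antisymmetric functions at once. *)
Lemma antisym_split g u v : antisym g -> antisym (fun a b => flux g (split_side u v (a, b))).
Proof.
move=> h a b; rewrite /split_side /= [ orient u v b * _]mulrC.
case: ifP => [ o|_]; last by rewrite /flux !big_seq1 h.
have n : orient u v a != orient u v b.
  by apply: contraTneq o => ->; rewrite -leNgt -expr2 sqr_ge0.
rewrite (interC n) /flux !big_cons !big_nil /= !addr0.
rewrite (h _ b) (h _ a).
by rewrite opprD opprK addrC.
Qed.

Lemma mem_links a b s : (a, b) \in links s -> a \in s /\ b \in s.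
Proof.
elim: s => [|x [|y s] IH] //; rewrite /links /= inE => /orP[/eqP[-> ->]|/IH[ha hb]].
  by rewrite !inE !eqxx orbT.
by rewrite ![_ \in x :: _]inE ha hb !orbT.
Qed.

(** A test function that detects cuts at [u]: when [h] is one open side of a diagonal at [u], it
    distinguishes the two outer sides at [u]. *)
Definition star u (h : pt -> bool) a b : int :=
  ((a == u) && h b : nat)%:Z - ((b == u) && h a : nat)%:Z.

Lemma antisym_star u h : antisym (star u h).
Proof. by move=> a b; rewrite /star opprB. Qed.

(** The outer side leaving [u] ends to the right of the diagonal, and the one arriving at [u] starts
    to its left, so exactly one term is nonzero. *)
Lemma star_hull s u v : polygon s -> u \in s -> v \in s -> u != v ->
  (u, v) \notin sides s -> (v, u) \notin sides s ->
  flux (star u (fun x => orient u v x < 0)) (sides s) != 0.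
Proof.
move=> pol us vs uv nuv nvu; have [k [z [w [y e]]]] := corner_at pol us.
have polk := polygon_rot k pol.
rewrite -(mem_sides_rot k s) e sides_corner !(inE, mem_rcons) !negb_or in nuv.
rewrite -(mem_sides_rot k s) e sides_corner !(inE, mem_rcons) !negb_or in nvu.
have vz : v != z by case/andP: nuv; rewrite xpair_eqE eqxx.
have vy : v != y by case/and3P: nvu => _; rewrite xpair_eqE eqxx andbT.
have vw : v \in w.
  have := vs; rewrite -(mem_rot k s) e !inE mem_rcons inE.
  by rewrite [v == u]eq_sym (negPf uv) (negPf vz) (negPf vy).
have [_ tri] := polk; rewrite e in tri.
have oz : orient u v z < 0.
  rewrite orient_swapr oppr_lt0; apply: tri; rewrite /= !eqxx sub1seq.
  by rewrite mem_rcons inE vw orbT.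
have oy : 0 < orient u v y.
  by apply: tri; rewrite /= eqxx (negPf vz) -cats1 subseq_mem2 // mem_head.
rewrite -(flux_perm _ (perm_sides_rot k s)) e sides_corner.
rewrite /flux big_cons -cats1 big_cat big_seq1 /= big1_seq => [|[a b] /andP[_ ab]].
  have yu : (y == u) = false by apply/eqP => ey; move: oy; rewrite ey orient_aba ltxx.
  have zu : (z == u) = false by apply/eqP => ez; move: oz; rewrite ez orient_aba ltxx.
  by rewrite /star eqxx oz zu yu (ltNge (orient u v y)) (ltW oy).
have un := polygon_uniq polk; rewrite e /= in un.
have /andP[unu _] := un.
have mem c : c \in z :: rcons w y -> (c == u) = false.
  by move=> cz; apply: contraNF unu => /eqP<-.
have [/mem at_ /mem bt] := mem_links ab.
by rewrite /star at_ bt.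
Qed.

(** A closed polygon enters each of its corners as often as it leaves it. *)
Lemma star_face u (h : pt -> bool) P :
  {in sides P, forall e, (e.1 == u -> h e.2) /\ (e.2 == u -> h e.1)} ->
  flux (star u h) (sides P) = 0.
Proof.
move=> hP; have : flux (star u h) (sides P) =
    (count_mem u (map fst (sides P)))%:Z - (count_mem u (map snd (sides P)))%:Z.
  elim: (sides P) hP => [|[a b] E IH] hE; first by rewrite /flux big_nil.
  rewrite /flux big_cons -/(flux (star u h) E) IH => [|e eE]; last by apply: hE; rewrite inE eE orbT.
  have [/= h1 h2] := hE (a, b) (mem_head _ _).
  rewrite /star /=; case: (a =P u) h1 => _ h1; case: (b =P u) h2 => _ h2 /=;
  by rewrite ?h1 ?h2 //; move: (count_mem u _) (count_mem u _); clear; lia.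
have /permP rot1P : perm_eq (rot 1 P) P by rewrite perm_rot.
by move=> ->; rewrite map_fst_sides map_snd_sides rot1P subrr.
Qed.

Lemma flux_allsides g F : flux g (allsides F) = \sum_(P <- F) flux g (sides P).
Proof.
elim: F => [|P F IH]; first by rewrite /flux !big_nil.
by rewrite allsides_cons flux_cat big_cons IH.
Qed.

(* If no face with corner [u] were cut, then [h] would be constant along each star of sides at [u],
   and the flux of [star u h] would vanish. *)
Lemma exists_cut_face s F u v : polygon s -> u \in s -> v \in s -> u != v ->
  (u, v) \notin sides s -> (v, u) \notin sides s ->
  (forall g, antisym g -> flux g (allsides F) = flux g (sides s)) ->
  {in allsides F, forall e, (e.1 == u -> orient u v e.2 != 0) /\
                            (e.2 == u -> orient u v e.1 != 0)} ->
  exists2 P, P \in F & (u \in P) && ~~ onesided u v P.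
Proof.
move=> pol us vs uv nuv nvu hflux hl; apply/hasP; apply: contraNT (star_hull pol us vs uv nuv nvu).
move=> /hasPn hF; rewrite -hflux; last exact: antisym_star.
rewrite flux_allsides big1_seq // => P /andP[_ PF].
have sub : {subset sides P <= allsides F}.
  by move=> e eP; apply/flattenP; exists (sides P) => //; apply: map_f.
have [uP|uP] := boolP (u \in P); last first.
  apply: star_face => -[a b] /mem_sides[aP bP] /=.
  by split=> /eqP ee; move: uP; rewrite -ee ?aP ?bP.
have := hF _ PF; rewrite uP /= negbK => /orP[] /allP h; last first.
  apply: star_face => -[a b] ab; have [aP bP] := mem_sides ab.
  have [/= h1 h2] := hl _ (sub _ ab); split=> [/h1|/h2] n; rewrite lt_neqAle n.
    exact: h.
  exact: h.
rewrite /flux big1_seq // => -[a b] /andP[_ /mem_sides[aP bP]].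
rewrite /star /= !ltNge; have := h _ aP; have := h _ bP => /= -> ->.
by rewrite !andbF.
Qed.
End Flux.

(** * The invariant of successive cuts along diagonals *)

Lemma step_excess (n k : nat) (a b c d e f g : int) :
  (12 - 5 * n%:Z + 2 * k%:Z <= a - b -> a + c <= d - e -> 2 <= c -> f = b -> g = f + e ->
  12 - 5 * n%:Z + 2 * k.+1%:Z <= d - g)%R.
Proof. lia. Qed.

(** Before any cut there is one face with [n] sides, both ends of each being vertices; this is where
    [12 - 5 * n] comes from. *)
Lemma base_excess (n : nat) (a b : int) : (a = 12 - 3 * n%:Z -> b = 2 * n%:Z ->
  12 - 5 * n%:Z + 2 * 0%:Z <= a - b)%R.
Proof. lia. Qed.

Section Dissection.
Local Open Scope ring_scope.
Variable R : realFieldType.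
Notation pt := (R * R)%type.
Implicit Types (a b c d p q u v x y : pt) (P A B C s t : seq pt) (F : seq (seq pt)).
Implicit Types (ds : seq (pt * pt)).

(** The state after cutting along the diagonals [ds]. That the faces fit together is recorded only
    through [dis_flux]; [dis_line] keeps every side on a chord, and in [dis_excess] every diagonal
    contributes 2. *)
Record dissection s F ds : Prop := Dissection {
  dis_polygon : {in F, forall P, polygon P};
  dis_onesided : {in F, forall P, {in ds, forall e, onesided e.1 e.2 P}};
  dis_inhull : {in F, forall P, {in P, forall x, inhull s x}};
  dis_line : {in allsides F, forall e, exists2 d, d \in sides s ++ ds &
    orient d.1 d.2 e.1 = 0 /\ orient d.1 d.2 e.2 = 0};
  dis_flux : forall g, antisym g -> flux g (allsides F) = flux g (sides s);
  dis_excess : 12 - 5 * (size s)%:Z + 2 * (size ds)%:Z <=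
    \sum_(P <- F) excess P - \sum_(e <- allsides F) vertex_ends s e
}.

Lemma dissection0 s : polygon s -> dissection s [:: s] [::].
Proof.
move=> pol; have as1 : allsides [:: s] = sides s by rewrite /allsides /= cats0.
split; rewrite ?as1 //.
- by move=> P; rewrite inE => /eqP->.
- by move=> P; rewrite inE => /eqP-> x; apply: polygon_inhull.
- by move=> [a b] ab; exists (a, b); rewrite ?mem_cat ?ab // orient_aba orient_baa.
apply: base_excess; first by rewrite big_seq1.
rewrite -(size_sides s); have : {subset sides s <= sides s} by [].
elim: {1 3 4}(sides s) => [|[a b] E IH] sub; first by rewrite big_nil.
rewrite big_cons IH => [|e eE]; last by apply: sub; rewrite inE eE orbT.
have [as_ bs] := mem_sides (sub (a, b) (mem_head _ _)).
by rewrite /vertex_ends as_ bs /=; lia.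
Qed.

Lemma line_transfer x y u c v : u != c -> orient x y u = 0 -> orient x y c = 0 ->
  orient u c v = 0 -> orient x y v = 0.
Proof.
by move=> uc hu hc /(line_between uc)[k ->]; rewrite orient_between hu hc !mulr0 addr0.
Qed.

Lemma side_of_allsides F e : e \in allsides F -> exists2 P, P \in F & e \in sides P.
Proof. by case/flattenP => E /mapP[P PF ->] eP; exists P. Qed.

Lemma split_vertex_ends V u v (E : seq (pt * pt)) :
  {in E, forall e, orient u v e.1 * orient u v e.2 < 0 -> inter u v e.1 e.2 \notin V} ->
  \sum_(e <- flatten (map (split_side u v) E)) vertex_ends V e = \sum_(e <- E) vertex_ends V e.
Proof.
elim: E => [|e E IH] h; first by rewrite /= !big_nil.
rewrite [flatten _]/= big_cat big_cons IH => [|x xE]; last by apply: h; rewrite inE xE orbT.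
congr (_ + _); rewrite /split_side; case: ifP => o; last by rewrite big_seq1.
have := h _ (mem_head _ _) o => /negbTE q.
by rewrite !big_cons big_nil /vertex_ends /= q /=; lia.
Qed.

(** The two ends may belong to different cut faces, so their contributions are bounded
    separately. *)
Lemma gain_ge2 F u v (P Q : seq pt) : P \in F -> Q \in F ->
  u \in P -> v \in Q -> ~~ onesided u v P -> ~~ onesided u v Q ->
  2 <= \sum_(P <- F) gain u v P.
Proof.
move=> PF QF uP vQ nP nQ.
have -> : \sum_(P <- F) gain u v P =
    \sum_(P <- F) (if onesided u v P then 0 else (u \in P : nat)%:Z) +
    \sum_(P <- F) (if onesided u v P then 0 else (v \in P : nat)%:Z) :> int.
  by rewrite -big_split; apply: eq_bigr => X _; rewrite /gain; case: ifP.
have ge1 w (X : seq pt) : X \in F -> w \in X -> ~~ onesided u v X ->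
    1 <= \sum_(P <- F) (if onesided u v P then 0 else (w \in P : nat)%:Z) :> int.
  move=> XF wX nX; rewrite (big_rem X) //= (negPf nX) wX lerDl.
  by apply: sumr_ge0 => Y _; case: ifP.
by apply: (@lerD _ 1 _ 1); [apply: (ge1 _ P) | apply: (ge1 _ Q)].
Qed.

Lemma weight01 (x y : R) : x * y < 0 -> 0 < x / (x - y) < 1.
Proof.
wlog x0 : x y / 0 < x.
  move=> h xy; have [/h|x0] := ltP 0 x; first exact.
  have -> : x / (x - y) = - x / (- x - - y) by rewrite -opprD invrN mulrNN.
  apply: h; last by rewrite mulrNN.
  by rewrite oppr_gt0 lt_neqAle x0 andbT; apply: contraTneq xy => ->; rewrite mul0r ltxx.
rewrite pmulr_rlt0 // => y0; have h : 0 < x - y by lra.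
by rewrite divr_gt0 //= ltr_pdivrMr // mul1r; lra.
Qed.

(** Consequently no cut subdivides an outer side, and the flux through the outer polygon stays the
    same. *)
Lemma hull_side_onesided s a b u v : polygon s -> (a, b) \in sides s ->
  u \in s -> v \in s -> 0 <= orient u v a * orient u v b.
Proof.
move=> pol ab us vs; have [k [t e]] := side_at pol ab.
have [_ tri] := polygon_rot k pol; rewrite e in tri.
have [->|uv] := eqVneq u v; first by rewrite !orient_aab mulr0.
have [->|ua] := eqVneq u a; first by rewrite orient_aba mul0r.
have [->|ub] := eqVneq u b; first by rewrite orient_aba mulr0.
have [->|va] := eqVneq v a; first by rewrite orient_baa mul0r.
have [->|vb] := eqVneq v b; first by rewrite orient_baa mulr0.
have ut : u \in t by move: us; rewrite -(mem_rot k s) e !inE (negPf ua) (negPf ub).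
have vt : v \in t by move: vs; rewrite -(mem_rot k s) e !inE (negPf va) (negPf vb).
have pos x y : subseq [:: x; y] t -> 0 < orient x y a /\ 0 < orient x y b.
  move=> xy; rewrite -!(orient_cycle _ x y); split; apply: tri.
    by apply: (@cat_subseq _ [:: a] [:: x; y] [:: a; b]); rewrite // sub1seq mem_head.
  by apply: (@cat_subseq _ [:: b] [:: x; y] [:: a; b]); rewrite // sub1seq !inE eqxx orbT.
have [/pos[h1 h2]|/pos[]] := subseq2_or uv ut vt; first by rewrite mulr_ge0 // ltW.
by rewrite !(orient_swap u v) !oppr_gt0 => h1 h2; rewrite mulr_le0 // ltW.
Qed.

(** Applied at both ends of the new diagonal, [exists_cut_face] gives cut faces with these ends as
    corners, hence a gain of at least 2. *)
Lemma dissection_step s F ds u v : polygon s -> dissection s F ds ->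
  u \in s -> v \in s -> u != v ->
  (u, v) \notin sides s ++ ds -> (v, u) \notin sides s ++ ds ->
  {in ds, forall e, [/\ e.1 \in s, e.2 \in s & e.1 != e.2]} ->
  exists F', dissection s F' ((u, v) :: ds).
Proof.
move=> pol [dpol done_ dhull dline dflux dexc] us vs uv nuv nvu hds.
have dss (d : pt * pt) : d \in sides s ++ ds -> [/\ d.1 \in s, d.2 \in s & d.1 != d.2].
  rewrite mem_cat => /orP[|/hds//]; case: d => a b ab.
  by have [as_ bs] := mem_sides ab; rewrite /= as_ bs (side_neq pol ab).
have hull_extreme P x : P \in F -> x \in s -> cut_point P x -> x \in P.
  move=> PF xs [//|[a [b [k [aP bP ab k01 ex]]]]].
  have := polygon_extreme pol (dhull _ PF _ aP) (dhull _ PF _ bP) ab k01.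
  by rewrite -ex xs.
(* A side at [u] or [v] cannot run along the new diagonal: it lies on an earlier chord, which by
   [chord_unique] would be the new one. *)
have offline (e : pt * pt) : e \in allsides F ->
    (e.1 == u -> orient u v e.2 != 0) /\ (e.2 == u -> orient u v e.1 != 0) /\
    (e.1 == v -> orient u v e.2 != 0) /\ (e.2 == v -> orient u v e.1 != 0).
  move=> eF; have [P PF eP] := side_of_allsides eF.
  have [[d1 d2] dd [h1 h2]] := dline _ eF; have [/= d1s d2s d12] := dss _ dd.
  have e12 : e.1 != e.2 by case: (e) eP => a b /(side_neq (dpol _ PF)).
  have key w w' c : orient d1 d2 w = 0 -> orient d1 d2 c = 0 -> w != c ->
      orient w c w' = 0 -> w \in s -> w' \in s -> (w, w') = (u, v) \/ (w, w') = (v, u) -> False.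
    move=> hw hc wc hw' ws w's ww'.
    have ww'n : w != w' by case: ww' => -[-> ->] //; rewrite eq_sym.
    have := chord_unique pol d1s d2s ws w's d12 ww'n hw (line_transfer wc hw hc hw').
    case=> -[e1 e2]; case: ww' => -[e3 e4]; move: dd; rewrite -e1 -e2 e3 e4;
    by rewrite ?(negPf nuv) ?(negPf nvu).
  have swap w w' c : orient w w' c = 0 -> orient w c w' = 0.
    by rewrite orient_swapr => /eqP; rewrite oppr_eq0 => /eqP.
  have swapl w w' c : orient w w' c = 0 -> orient w' w c = 0.
    by rewrite (orient_swap w') => /eqP; rewrite oppr_eq0 => /eqP.
  case: e {eF eP} h1 h2 e12 => a b /= h1 h2 ab.
  split; [|split; [|split]] => /eqP ee; apply/eqP => o.
  - subst a; apply: (key u v b) => //; [exact: swap | by left].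
  - subst b; apply: (key u v a) => //; [by rewrite eq_sym | exact: swap | by left].
  - subst a; apply: (key v u b) => //; [exact/swap/swapl | by right].
  - subst b; apply: (key v u a) => //; [by rewrite eq_sym | exact/swap/swapl | by right].
have nuv' : (u, v) \notin sides s by apply: contra nuv; rewrite mem_cat => ->.
have nvu' : (v, u) \notin sides s by apply: contra nvu; rewrite mem_cat => ->.
have [P PF /andP[uP nP]] : exists2 P, P \in F & (u \in P) && ~~ onesided u v P.
  apply: (exists_cut_face pol us vs) => // e /offline[h1 [h2 _]]; by split.
have [Q QF /andP[vQ nQ]] : exists2 P, P \in F & (v \in P) && ~~ onesided v u P.
  apply: (exists_cut_face pol vs us) => //; first by rewrite eq_sym.
  move=> e /offline[_ [_ [h1 h2]]]; rewrite ![ orient v u _]orient_swap !oppr_eq0; by split.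
have [F' [ch [polF' lch pe ex]]] := cut_faces uv dpol (fun P PF x xs => @hull_extreme P x PF xs).
(* The subdividing point is strictly inside a segment of the hull, so it is no vertex, and
   subdivision leaves the number of vertex ends unchanged. *)
have csplit (e : pt * pt) : e \in allsides F -> orient u v e.1 * orient u v e.2 < 0 ->
    inter u v e.1 e.2 \notin s.
  move=> eF o; have [X XF eX] := side_of_allsides eF.
  case: e eF o eX => a b /= eF o abX; have [aX bX] := mem_sides abX.
  have [k [k01 ->]] : exists k, 0 < k < 1 /\ inter u v a b = between k a b.
    exists (orient u v a / (orient u v a - orient u v b)); split=> //; exact: weight01.
  apply: (polygon_extreme pol) => //; rewrite ?(dhull _ XF) //.
  exact: (side_neq (dpol _ XF) abX).
exists F'; split.
- by move=> P' /polF'[].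
- move=> P' P'F e; rewrite inE => /orP[/eqP->|eds]; first by case: (polF' _ P'F).
  have [_ _ [X XF cX]] := polF' _ P'F.
  by apply: cut_point_onesided cX _; apply: done_.
- move=> P' P'F; have [_ _ [X XF cX]] := polF' _ P'F.
  exact: (cut_point_inhull cX (dhull _ XF)).
- move=> e; rewrite (perm_mem pe) mem_cat => /orP[].
    case/flattenP => E /mapP[[a b] abF ->].
    have [d dd [h1 h2]] := dline _ abF; rewrite /= in h1 h2.
    have dd' : d \in sides s ++ (u, v) :: ds.
      by move: dd; rewrite !mem_cat inE => /orP[->|->]; rewrite ?orbT.
    have hi : orient d.1 d.2 (inter u v a b) = 0 by rewrite orient_between h1 h2 !mulr0 addr0.
    rewrite /split_side; case: ifP => _; rewrite !inE.
      by case/orP => /eqP->; exists d.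
    by move/eqP->; exists d.
  case/flattenP => E /mapP[q qch ->]; have [l1 l2 _] := lch _ qch.
  by rewrite !inE => /orP[] /eqP->; exists (u, v) => //=; rewrite mem_cat inE eqxx orbT.
- move=> g hg; rewrite (flux_perm _ pe) flux_cat (flux_both_ways _ hg) addr0 flux_split.
  rewrite dflux; last exact: antisym_split.
  apply: eq_big_seq => -[a b] ab; rewrite /split_side /= ifF; first by rewrite /flux big_seq1.
  by apply/negbTE; rewrite -leNgt; apply: (hull_side_onesided pol).
- apply: (step_excess dexc ex (gain_ge2 PF QF uP vQ nP _)).
  + by rewrite onesidedC.
  + exact: (split_vertex_ends csplit).
  + by rewrite (perm_big _ pe) big_cat.
Qed.
End Dissection.

(** The range of [i] omits the sides between consecutive corners; the pair removed is the side that
    joins the last corner to the first. *)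
Definition diagonals n : seq (nat * nat) :=
  rem (0%N, n.-1) [seq (i, j) | j <- iota 0 n, i <- iota 0 j.-1].

Lemma mem_all_pairs n i j :
  ((i, j) \in [seq (i, j) | j <- iota 0 n, i <- iota 0 j.-1]) = (i.+1 < j < n)%N.
Proof.
apply/allpairsPdep/idP => [[y [x [yn xy [-> ->]]]]|/andP[ij jn]].
  by move: yn xy; rewrite !mem_iota; lia.
by exists j, i; rewrite !mem_iota; split=> //; lia.
Qed.

Lemma uniq_all_pairs n : uniq [seq (i, j) | j <- iota 0 n, i <- iota 0 j.-1].
Proof.
apply: allpairs_uniq_dep; [exact: iota_uniq | by move=> *; exact: iota_uniq|].
by move=> [x y] [x' y'] _ _ /= [-> ->].
Qed.

Lemma mem_diagonals n i j :
  ((i, j) \in diagonals n) = (i.+1 < j < n)%N && ((i, j) != (0%N, n.-1)).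
Proof. by rewrite mem_rem_uniq ?uniq_all_pairs // inE mem_all_pairs andbC. Qed.

Lemma uniq_diagonals n : uniq (diagonals n).
Proof. exact/rem_uniq/uniq_all_pairs. Qed.

Lemma size_diagonals n : (3 <= n)%N -> (2 * size (diagonals n) + 3 * n = n * n)%N.
Proof.
move=> n3; rewrite size_rem; last by rewrite mem_all_pairs; lia.
rewrite size_allpairs_dep; have e m : (2 * sumn [seq size (iota 0 y.-1) | y <- iota 0 m.+1] + m = m * m)%N.
  elim: m => // m IH; rewrite -[m.+2]addn1 iotaD map_cat sumn_cat; move: IH.
  by move: (sumn [seq _ | y <- iota 0 m.+1]) => S; rewrite /= size_iota; nia.
case: n n3 => // n n3; have := e n; have : (0 < sumn [seq size (iota 0 y.-1) | y <- iota 0 n.+1])%N.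
  have := e n; nia.
by rewrite -subn1; nia.
Qed.

(** * Cutting along all diagonals *)

Section Diagonals.
Local Open Scope ring_scope.
Variable R : realFieldType.
Notation pt := (R * R)%type.
Implicit Types (a b c d p q u v x y : pt) (P A B C s t : seq pt) (F : seq (seq pt)).
Implicit Types (ds : seq (pt * pt)).

Lemma sides_index s a b : uniq s -> (a, b) \in sides s ->
  (index b s = (index a s).+1)%N \/ (index a s = (size s).-1 /\ index b s = 0)%N.
Proof.
move=> un /(nthP (a, a))[i]; rewrite size_sides => si.
rewrite /sides nth_zip ?size_rot // => -[<-].
case: s un si => // x t un si; rewrite rot1_cons nth_rcons => <-.
rewrite index_uniq //; case: ltnP => it.
  by left; set d := nth a _ i; rewrite -[nth d t i]/(nth d (x :: t) i.+1) index_uniq.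
right; have -> : i = size t by apply/eqP; rewrite eqn_leq it andbT -ltnS.
by rewrite eqxx /= eqxx.
Qed.

Definition chord_of s (ij : nat * nat) : pt * pt := (nth 0 s ij.1, nth 0 s ij.2).

Lemma dissection_diagonals s (I : seq (nat * nat)) : polygon s -> uniq I ->
  {subset I <= diagonals (size s)} -> exists F, dissection s F (map (chord_of s) I).
Proof.
move=> pol; have un := polygon_uniq pol.
elim: I => [|[i j] I IH]; first by exists [:: s]; apply: dissection0.
move=> /andP[nI uI] sub.
have [|F dF] := IH uI; first by move=> ij ijI; apply: sub; rewrite inE ijI orbT.
have dg ij : ij \in (i, j) :: I -> (ij.1 < ij.2 < size s)%N.
  by case: ij => i' j' /sub; rewrite mem_diagonals => /andP[/andP[/ltnW-> ->]].
have /= := dg _ (mem_head _ _) => /andP[ij js].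
have is_ := ltn_trans ij js.
have ns k k' : ~~ ((k == k'.+1) || (k' == (size s).-1) && (k == 0%N)) ->
    (k < size s)%N -> (k' < size s)%N ->
    (nth 0 s k', nth 0 s k) \notin sides s.
  move=> h ks k's; apply: contra h => /(sides_index un); rewrite !index_uniq //.
  by case=> [->|[-> ->]]; rewrite eqxx ?orbT.
have := sub _ (mem_head _ _); rewrite mem_diagonals xpair_eqE => dij.
apply: (dissection_step pol dF); rewrite ?mem_nth //.
- by rewrite nth_uniq // ltn_eqF.
- rewrite mem_cat negb_or ns //=; last by lia.
  apply/mapP => -[[i' j'] I' []]; have /= := dg (i', j'); rewrite inE I' orbT => /(_ isT) /andP[i'j' j's].
  move=> /eqP; rewrite nth_uniq // ?(ltn_trans i'j') // => /eqP ei /eqP; rewrite nth_uniq // => /eqP ej.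
  by move: nI; rewrite ei ej I'.
- rewrite mem_cat negb_or ns //=; last by lia.
  apply/mapP => -[[i' j'] I' []]; have /= := dg (i', j'); rewrite inE I' orbT => /(_ isT) /andP[i'j' j's].
  move=> /eqP; rewrite nth_uniq // ?(ltn_trans i'j') // => /eqP ei /eqP; rewrite nth_uniq // => /eqP ej.
  by move: i'j'; rewrite -ei -ej; lia.
- move=> e /mapP[[i' j'] I' ->]; have /= := dg (i', j'); rewrite inE I' orbT => /(_ isT) /andP[i'j' j's].
  by rewrite !mem_nth ?(ltn_trans i'j') // nth_uniq ?(ltn_trans i'j') // ltn_eqF.
Qed.

Definition all_chords s ds := forall x y, x \in s -> y \in s -> x != y ->
  ((x, y) \in sides s ++ ds) || ((y, x) \in sides s ++ ds).

Lemma sides_nth s i : (i.+1 < size s)%N -> (nth 0 s i, nth 0 s i.+1) \in sides s.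
Proof.
move=> si; apply/(nthP (0, 0)); exists i; first by rewrite size_sides ltnW.
rewrite /sides nth_zip ?size_rot //; case: s si => // x t si.
by rewrite rot1_cons nth_rcons -ltnS si.
Qed.

Lemma sides_nth_last s : (0 < size s)%N -> (nth 0 s (size s).-1, nth 0 s 0%N) \in sides s.
Proof.
move=> s0; apply/(nthP (0, 0)); exists (size s).-1; first by rewrite size_sides prednK.
rewrite /sides nth_zip ?size_rot //; case: s s0 => // x t _.
by rewrite rot1_cons nth_rcons /= ltnn eqxx.
Qed.

Lemma exists_dissection s : polygon s -> exists F ds,
  [/\ dissection s F ds, all_chords s ds,
      {in ds, forall e, [/\ e.1 \in s, e.2 \in s & e.1 != e.2]} &
      (2 * size ds + 3 * size s = size s * size s)%N].
Proof.
move=> pol; have un := polygon_uniq pol.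
have [|F dF] := @dissection_diagonals s (diagonals (size s)) pol (uniq_diagonals _); first by [].
exists F, (map (chord_of s) (diagonals (size s))); split=> //.
- suff cov i j : (i < j < size s)%N ->
      ((nth 0 s i, nth 0 s j) \in sides s ++ map (chord_of s) (diagonals (size s))) ||
      ((nth 0 s j, nth 0 s i) \in sides s ++ map (chord_of s) (diagonals (size s))).
    move=> x y xs ys xy; rewrite -(nth_index 0 xs) -(nth_index 0 ys).
    have xs' := xs; have ys' := ys; rewrite -index_mem in xs'; rewrite -index_mem in ys'.
    have [xy'|yx|e] := ltngtP (index x s) (index y s); first by apply: cov; rewrite xy'.
      by rewrite orbC; apply: cov; rewrite yx.
    by move: xy; rewrite -(nth_index 0 xs) e (nth_index 0 ys) eqxx.
  move=> /andP[ij js]; rewrite !mem_cat.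
  have [ej|nij] := eqVneq j i.+1.
    by rewrite ej in js *; rewrite sides_nth.
  have [/andP[/eqP-> /eqP->]|n0] := boolP ((i == 0%N) && (j == (size s).-1)).
    by rewrite sides_nth_last ?orbT // (leq_ltn_trans _ js).
  have : (i, j) \in diagonals (size s) by rewrite mem_diagonals xpair_eqE n0 andbT js andbT ltn_neqAle eq_sym nij.
  by move/(map_f (chord_of s)) => ->; rewrite orbT.
- move=> e /mapP[[i j]]; rewrite mem_diagonals => /andP[/andP[ij js] _] ->.
  have is_ : (i < size s)%N by lia.
  by rewrite /= !mem_nth // nth_uniq //; split=> //; lia.
- by rewrite size_map size_diagonals // polygon_size.
Qed.
End Diagonals.

(** * Discharging *)

(** Here [a], [b], [c], [d] are the totals of [excess], [vertex_ends], [touch] and the indicator of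
    outer sides. The left side is (n - 2)(n - 6), while a - b <= -d <= -n; together (n - 3)(n - 4)
    <= 0. *)
Lemma discharging_arith (n k : nat) (a b c d : int) : (2 * k + 3 * n = n * n)%N -> (4 < n)%N ->
  (12 - 5 * n%:Z + 2 * k%:Z <= a - b -> a <= c -> c + d <= b -> n%:Z <= d -> False)%R.
Proof. nia. Qed.

Section Discharging.
Local Open Scope ring_scope.
Variable R : realFieldType.
Notation pt := (R * R)%type.
Implicit Types (a b c d p q u v x y : pt) (P A B C s t : seq pt) (F : seq (seq pt)).
Implicit Types (e f g : pt * pt) (ds : seq (pt * pt)).

Definition cross e f : R :=
  (e.2.1 - e.1.1) * (f.2.2 - f.1.2) - (e.2.2 - e.1.2) * (f.2.1 - f.1.1).

Definition same_chord e f := (e == f) || (e == (f.2, f.1)).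

(** Genericity in terms of lines through vertices: for [x] in the hull, lying on the line of a chord
    means lying on the chord itself. *)
Definition generic s := forall x e f g, inhull s x -> x \notin s ->
  (forall h, h \in [:: e; f; g] ->
     [/\ h.1 \in s, h.2 \in s, h.1 != h.2 & orient h.1 h.2 x = 0]) ->
  [|| same_chord e f, same_chord f g | same_chord e g].

Lemma same_chord_orient e f x : same_chord e f -> orient f.1 f.2 x = 0 -> orient e.1 e.2 x = 0.
Proof.
by case/orP => /eqP-> //= h; rewrite orient_swap h oppr0.
Qed.

Section Discharge.
Variables (s : seq pt) (E : seq (pt * pt)).

Hypothesis gen : generic s.
Hypothesis hE : {in E, forall e, [/\ e.1 \in s, e.2 \in s & e.1 != e.2]}.

(** A chord through [a] that does not contain [b], found from the side alone and not from a face, so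
    that both faces along the side use the same chord. The antisymmetry of [charge] is formal and
    also covers the default value. *)
Definition crossing_chord a b : pt * pt :=
  nth (0, 0) E (find (fun e => (orient e.1 e.2 a == 0) && (orient e.1 e.2 b != 0)) E).

(* The sign of convergence, to the left of [a b], of the chords crossing it at [a] and at [b]. *)
Definition charge a b : int :=
  if (a \in s) || (b \in s) then 0 else
  sgz (cross (a, b) (crossing_chord a b) * cross (a, b) (crossing_chord b a) *
       cross (crossing_chord a b) (crossing_chord b a)).

(** Exchanging the ends reverses [(a, b)] in two factors, which cancels, and exchanges the chords in
    the third factor. *)
Lemma antisym_charge : antisym charge.
Proof.
move=> a b; rewrite /charge orbC; case: ifP => _; first by rewrite oppr0.
by rewrite -sgzN; congr sgz; rewrite /cross; ring.
Qed.

Lemma charge_ge a b : -1 <= charge a b.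
Proof. by rewrite /charge; case: ifP => // _; case: sgzP. Qed.

Section Side.
Variables p0 p1 p2 p3 : pt.
Hypotheses (o1 : 0 < orient p0 p1 p2) (o2 : 0 < orient p1 p2 p3).
Hypotheses (h1 : inhull s p1) (h2 : inhull s p2).
Hypothesis l01 : exists2 e, e \in E & orient e.1 e.2 p0 = 0 /\ orient e.1 e.2 p1 = 0.
Hypothesis l12 : exists2 e, e \in E & orient e.1 e.2 p1 = 0 /\ orient e.1 e.2 p2 = 0.
Hypothesis l23 : exists2 e, e \in E & orient e.1 e.2 p2 = 0 /\ orient e.1 e.2 p3 = 0.

Lemma line_parallel e a b : e.1 != e.2 -> a != b -> orient e.1 e.2 a = 0 -> orient e.1 e.2 b = 0 ->
  exists2 k, k != 0 & forall f, cross (a, b) f = k * cross e f /\ cross f (a, b) = k * cross f e.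
Proof.
move=> e12 ab /(line_between e12)[ka ea] /(line_between e12)[kb eb].
exists (kb - ka).
  by rewrite subr_eq0; apply: contraNneq ab => kk; rewrite ea eb kk.
by move=> f; rewrite ea eb /cross /between /=; split; ring.
Qed.

(** Three chords pass through [b]: [e] along [ab], [f] along [bc], and the chosen one. By genericity
    two of them agree. Since [c] lies on [f] but neither on [e] nor on the chosen chord, the chosen
    chord is [e]. *)
Lemma crossing_chord_parallel a b c : inhull s b -> b \notin s -> orient a b c != 0 ->
  (exists2 e, e \in E & orient e.1 e.2 a = 0 /\ orient e.1 e.2 b = 0) ->
  (exists2 e, e \in E & orient e.1 e.2 b = 0 /\ orient e.1 e.2 c = 0) ->
  exists2 k, k != 0 & forall f, cross (b, a) f = k * cross (crossing_chord b c) f /\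
                                cross f (b, a) = k * cross f (crossing_chord b c).
Proof.
move=> hb bs o [e eE [ea eb]] [f fE [fb fc]].
have ab : a != b by apply: contraNneq o => ->; rewrite orient_aab.
have bc : b != c by apply: contraNneq o => ->; rewrite orient_baa.
have [e1 e2 e12] := hE eE; have [f1 f2 f12] := hE fE.
have line3 g : g.1 != g.2 -> orient g.1 g.2 a = 0 -> orient g.1 g.2 b = 0 ->
    orient g.1 g.2 c = 0 -> False.
  move=> g12 /(line_between g12)[ka ea'] /(line_between g12)[kb eb'] /(line_between g12)[kc ec'].
  by move/eqP: o; apply; rewrite ea' eb' ec' /orient /between /=; ring.
have ec : orient e.1 e.2 c != 0 by apply/eqP => ec; apply: (line3 e).
have hasE : has (fun e => (orient e.1 e.2 b == 0) && (orient e.1 e.2 c != 0)) E.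
  by apply/hasP; exists e => //=; rewrite eb eqxx.
have /andP[/eqP ob oc] := nth_find (0, 0) hasE.
have oE : crossing_chord b c \in E by rewrite mem_nth // -has_find.
rewrite -/(crossing_chord b c) in ob oc; have [ o1' o2' o12] := hE oE.
have := gen hb bs (e := e) (f := f) (g := crossing_chord b c).
case/(_ _)/or3P => [h|sc|sc|sc].
- by rewrite !inE => /or3P[] /eqP->.
- by move: ec; rewrite (same_chord_orient sc fc) eqxx.
- move: oc; rewrite (@same_chord_orient (crossing_chord b c) f) ?eqxx //.
  case/orP: sc => /eqP ->; first by rewrite /same_chord eqxx.
  by rewrite /same_chord /= -surjective_pairing eqxx orbT.
- have oa : orient (crossing_chord b c).1 (crossing_chord b c).2 a = 0.
    apply: (same_chord_orient (f := e)) => //.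
    case/orP: sc => /eqP ->; first by rewrite /same_chord eqxx.
    by rewrite /same_chord /= -surjective_pairing eqxx orbT.
  by apply: line_parallel; rewrite // eq_sym.
Qed.

Lemma charge_side : p1 \notin s -> p2 \notin s -> charge p1 p2 = sgz (cross (p1, p0) (p2, p3)).
Proof.
move=> n1 n2; rewrite /charge (negPf n1) (negPf n2).
have [k k0 hk] := crossing_chord_parallel h1 n1 (lt0r_neq0 o1) l01 l12.
have o2' : orient p3 p2 p1 != 0.
  by rewrite orient_cycle orient_swap oppr_eq0 lt0r_neq0.
have flip a b : (exists2 e, e \in E & orient e.1 e.2 a = 0 /\ orient e.1 e.2 b = 0) ->
   (exists2 e, e \in E & orient e.1 e.2 b = 0 /\ orient e.1 e.2 a = 0).
  by case=> e eE [ea eb]; exists e.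
have [k' k0' hk'] := crossing_chord_parallel h2 n2 o2' (flip _ _ l23) (flip _ _ l12).
have e1 : cross (p1, p2) (p1, p0) = orient p0 p1 p2 by rewrite /cross /orient /=; ring.
have e2 : cross (p1, p2) (p2, p3) = orient p1 p2 p3 by rewrite /cross /orient /=; ring.
have e3 : cross (p1, p0) (p2, p3) = k * (k' * cross (crossing_chord p1 p2) (crossing_chord p2 p1)).
  by rewrite (hk _).1 (hk' _).2.
have -> : sgz (cross (p1, p0) (p2, p3)) =
    sgz (cross (p1, p2) (p1, p0) * cross (p1, p2) (p2, p3) * cross (p1, p0) (p2, p3)).
  by rewrite !sgzM e1 e2 (gtr0_sgz o1) (gtr0_sgz o2) !mul1r.
rewrite e3 (hk _).2 (hk' _).2.
set x := cross _ _; set y := cross _ _; set z := cross _ _.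
(* The unknown orientations of the chosen chords enter only through a square; the first two factors
   in [charge] are there for this. *)
have -> : k * x * (k' * y) * (k * (k' * z)) = (k * k') ^+ 2 * (x * y * z) by ring.
have kk : 0 < (k * k') ^+ 2 by rewrite exprn_even_gt0 //= mulf_neq0.
by rewrite (sgzM ((k * k') ^+ 2)) (gtr0_sgz kk) mul1r.
Qed.
End Side.

Definition touch e : int := ((e.1 \in s) || (e.2 \in s) : nat)%:Z.

(** A side with a vertex end has charge 0 and so gets 1, the largest possible sign. The estimates
    for the faces then hold for it as for a converging side. *)
Definition toll e : int := charge e.1 e.2 + touch e.

Lemma toll_touch e : touch e != 0 -> toll e = 1.
Proof. by rewrite /toll /charge /touch; case: ifP. Qed.

Lemma toll_charge e : touch e = 0 -> e.1 \notin s /\ e.2 \notin s /\ toll e = charge e.1 e.2.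
Proof.
by rewrite /toll => t; rewrite t addr0; move: t; rewrite /touch; case: (e.1 \in s); case: (e.2 \in s).
Qed.

Lemma toll_ge e : -1 <= toll e.
Proof.
by have := charge_ge e.1 e.2; rewrite /toll /touch; case: (_ || _) => /=; lia.
Qed.

Section Face.
Variable P : seq pt.
Hypothesis polP : polygon P.
Hypothesis hP : {in P, forall x, inhull s x}.
Hypothesis hl : {in sides P, forall e, exists2 d, d \in E &
    orient d.1 d.2 e.1 = 0 /\ orient d.1 d.2 e.2 = 0}.

Lemma toll_side p0 p1 p2 p3 : (p0, p1) \in sides P -> (p1, p2) \in sides P ->
  (p2, p3) \in sides P -> 0 < orient p0 p1 p2 -> 0 < orient p1 p2 p3 ->
  touch (p1, p2) = 0 -> toll (p1, p2) = sgz (cross (p1, p0) (p2, p3)).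
Proof.
move=> s01 s12 s23 o1 o2 /toll_charge[/= n1 [n2 ->]].
have [m1 m2] := mem_sides s12.
by apply: charge_side => //; [exact: hP | exact: hP | exact: (hl s01) | exact: (hl s12) | exact: (hl s23)].
Qed.

Lemma toll_triangle a b c : perm_eq (sides P) [:: (a, b); (b, c); (c, a)] -> 0 < orient a b c ->
  toll (a, b) = 1.
Proof.
move=> e o; have [t|/toll_touch//] := eqVneq (touch (a, b)) 0.
rewrite (@toll_side c a b c) ?(perm_mem e) ?inE ?eqxx ?orbT //; last by rewrite orient_cycle.
by apply: gtr0_sgz; move: o; rewrite /cross /orient /=; lra.
Qed.

Lemma toll_quadrangle a b c d : perm_eq (sides P) [:: (a, b); (b, c); (c, d); (d, a)] ->
  0 < orient a b c -> 0 < orient b c d -> 0 < orient c d a -> 0 < orient d a b ->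
  0 <= toll (a, b) + toll (c, d).
Proof.
move=> e o1 o2 o3 o4; have ge := toll_ge.
have [t|/toll_touch->] := eqVneq (touch (a, b)) 0; last first.
  by have := ge (c, d); clear; lia.
have [t'|/toll_touch->] := eqVneq (touch (c, d)) 0; last first.
  by have := ge (a, b); clear; lia.
rewrite (@toll_side d a b c) ?(perm_mem e) ?inE ?eqxx ?orbT //.
rewrite (@toll_side b c d a) ?(perm_mem e) ?inE ?eqxx ?orbT //.
have -> : cross (c, b) (d, a) = - cross (a, d) (b, c) by rewrite /cross /=; ring.
by rewrite sgzN subrr.
Qed.

Lemma face_toll : size P <> 5%N -> excess P <= \sum_(e <- sides P) toll e.
Proof.
move=> n5; have sz := polygon_size polP.
have [big|small] := ltnP 5 (size P).
  apply: (@le_trans _ _ (- (size (sides P))%:Z)).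
    by rewrite size_sides /excess; move: big; clear; lia.
  elim: (sides P) => [|e L IH]; first by rewrite big_nil.
  by rewrite big_cons; have := toll_ge e; move: IH; clear; rewrite /=; lia.
have [_ tri] := polP.
case eP: P n5 sz small => [|a [|b [|c [|d [|? [|? ?]]]]]] //= _ _ _; rewrite eP in tri.
  have o : 0 < orient a b c by apply: tri; rewrite /= !eqxx.
  have eS : perm_eq (sides P) [:: (a, b); (b, c); (c, a)] by rewrite eP.
  have eS' : perm_eq (sides P) [:: (b, c); (c, a); (a, b)].
    by rewrite (perm_trans eS) // -(perm_rot 1) perm_refl.
  have eS'' : perm_eq (sides P) [:: (c, a); (a, b); (b, c)].
    by rewrite (perm_trans eS') // -(perm_rot 1) perm_refl.
  have o' : 0 < orient b c a by rewrite -orient_cycle.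
  have o'' : 0 < orient c a b by rewrite orient_cycle.
  rewrite -eP (perm_big _ eS) !big_cons big_nil.
  by rewrite (toll_triangle eS o) (toll_triangle eS' o') (toll_triangle eS'' o'') /excess eP.
have [ o1 o2 o3 o4] : [/\ 0 < orient b c d, 0 < orient a b d, 0 < orient a c d & 0 < orient a b c].
  by apply: (polygon_quad polP); rewrite eP.
have eS : perm_eq (sides P) [:: (a, b); (b, c); (c, d); (d, a)] by rewrite eP.
have eS' : perm_eq (sides P) [:: (b, c); (c, d); (d, a); (a, b)].
  by rewrite (perm_trans eS) // -(perm_rot 1) perm_refl.
have q1 : 0 <= toll (a, b) + toll (c, d).
  by apply: (toll_quadrangle eS) => //; rewrite // -orient_cycle // -orient_cycle.
have q2 : 0 <= toll (b, c) + toll (d, a).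
  by apply: (toll_quadrangle eS') => //; rewrite // -orient_cycle // -orient_cycle.
rewrite -eP (perm_big _ eS) !big_cons big_nil /excess eP /=.
by move: q1 q2; clear; lia.
Qed.
End Face.
End Discharge.

Lemma exists_pentagonal_face s : polygon s -> generic s -> (4 < size s)%N ->
  exists F ds, [/\ dissection s F ds, all_chords s ds,
    {in ds, forall e, [/\ e.1 \in s, e.2 \in s & e.1 != e.2]} &
    exists2 P, P \in F & size P = 5%N].
Proof.
move=> pol gen n5; have [F [ds [dis cov hds szd]]] := exists_dissection pol.
exists F, ds; split=> //; have [dpol done_ dhull dline dflux dexc] := dis.
have [/hasP[P PF /eqP eP]|/hasPn nF] := boolP (has (fun P => size P == 5%N) F).
  by exists P.
exfalso; set E := sides s ++ ds.
have hE : {in E, forall e, [/\ e.1 \in s, e.2 \in s & e.1 != e.2]}.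
  move=> -[a b]; rewrite mem_cat => /orP[ab|/hds//].
  by have [as_ bs] := mem_sides ab; rewrite /= as_ bs (side_neq pol ab).
have sub P : P \in F -> {subset sides P <= allsides F}.
  by move=> PF e eP; apply/flattenP; exists (sides P) => //; apply: map_f.
have sumF (w : pt * pt -> int) : \sum_(P <- F) \sum_(e <- sides P) w e = \sum_(e <- allsides F) w e.
  elim: {nF dis dpol done_ dhull dline dflux dexc sub} F => [|P F IH]; first by rewrite !big_nil.
  by rewrite allsides_cons big_cat big_cons IH.
pose hull (a b : pt) : int := ((a, b) \in sides s : nat)%:Z.
have ex_le : \sum_(P <- F) excess P <= \sum_(e <- allsides F) touch s e.
  (* The charges have total 0: their flux equals that of the outer polygon, where all ends are
     vertices. *)
  have -> : \sum_(e <- allsides F) touch s e = \sum_(e <- allsides F) toll s E e.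
    rewrite /toll big_split /= -/(flux (charge s E) _) dflux; last exact: antisym_charge.
    rewrite /flux [X in _ = X + _]big1_seq ?add0r // => -[a b] /andP[_ /mem_sides[as_ bs]].
    by rewrite /charge as_.
  rewrite -sumF big_seq [leRHS]big_seq; apply: ler_sum => P PF.
  apply: (face_toll gen hE (dpol _ PF) (dhull _ PF)).
    by move=> e /(sub _ PF)/dline.
  by apply/eqP; apply: nF.
(* The flux identity for the antisymmetrised indicator of outer sides: no outer side is also one in
   reverse, so the flux through [s] is [size s], and dropping the subtracted part can only increase
   the sum over the faces. *)
have hull_ge : (size s)%:Z <= \sum_(e <- allsides F) hull e.1 e.2.
  have := dflux (fun a b => hull a b - hull b a) (fun a b => esym (opprB _ _)).
  rewrite /flux !sumrB => eq1.
  have -> : (size s)%:Z = \sum_(e <- sides s) hull e.1 e.2 - \sum_(e <- sides s) hull e.2 e.1.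
    rewrite [X in _ - X]big1_seq; last first.
      move=> -[a b] /andP[_ ab]; rewrite /hull /=.
      have [k [t e]] := side_at pol ab; have := polygon_size (polygon_rot k pol).
      rewrite e; case: t e => // c t e _.
      have cs : c \in s by rewrite -(mem_rot k s) e !inE eqxx !orbT.
      have [_ tri] := polygon_rot k pol.
      have o : 0 < orient a b c by apply: tri; rewrite e /= !eqxx sub0seq.
      have [ba|//] := boolP ((b, a) \in sides s).
      by have := side_orient_ge0 pol ba cs; rewrite orient_swap oppr_ge0 leNgt o.
    rewrite subr0 -(size_sides s); have : {subset sides s <= sides s} by [].
    elim: {1 3 4}(sides s) => [|[a b] L IH] sb; first by rewrite big_nil.
    rewrite big_cons -IH => [|e eL]; last by apply: sb; rewrite inE eL orbT.
    by rewrite /hull (sb _ (mem_head _ _)) /=; lia.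
  rewrite -eq1 gerBl; apply: sumr_ge0 => e _; rewrite /hull; by case: (_ \in _).
apply: (discharging_arith szd n5 dexc ex_le _ hull_ge).
(* Side by side: [touch] is at most 1, and an outer side has two vertex ends, which leaves room for
   [hull]. *)
rewrite -big_split /=; apply: ler_sum => -[a b] _; rewrite /touch /vertex_ends /hull /=.
have [ab|nab] := boolP ((a, b) \in sides s).
  by have [-> ->] := mem_sides ab.
by case: (a \in s); case: (b \in s).
Qed.
End Discharging.

(** * Convex position and the topology of faces *)

Section ConvexSets.
Local Open Scope classical_set_scope.
Local Open Scope ring_scope.
Variable R : realType.
Notation pt := (plane R).
Implicit Types (a b c d p q u v x y : pt) (X Y : set pt) (s t P : seq pt).

Lemma betweenE (k : R) a b : (1 - k) *: a + k *: b = between k a b.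
Proof. by []. Qed.

Lemma convex_setP X : convex_set (X : set (convex_lmodType pt)) <->
  forall k a b, 0 <= k <= 1 -> X a -> X b -> X (between k a b).
Proof.
split=> [h k a b /andP[k0 k1] Xa Xb|h a b k /[!inE] Xa Xb].
  (* The library gives the parameter as weight to the first point, [between] to the second; hence
     the exchange. *)
  have := h b a (Itv01 k0 k1); rewrite !inE => /(_ Xb Xa).
  by rewrite -betweenE addrC.
have := h k%:num b a; rewrite -betweenE addrC; apply => //.
by rewrite ge0 le1.
Qed.

Lemma convex_hull_convex X k a b : 0 <= k <= 1 ->
  convex_hull X a -> convex_hull X b -> convex_hull X (between k a b).
Proof.
move=> k01 ha hb Y [cY XY]; move/convex_setP: (cY); apply => //.
  exact: ha.
exact: hb.
Qed.

Lemma sub_convex_hull X : X `<=` convex_hull X.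
Proof. exact: sub_gen_smallest. Qed.

Lemma convex_hull_min X Y : (forall k a b, 0 <= k <= 1 -> Y a -> Y b -> Y (between k a b)) ->
  X `<=` Y -> convex_hull X `<=` Y.
Proof. by move=> /convex_setP cY XY; apply: smallest_sub. Qed.

Lemma halfplane_convex u v k a b : 0 <= k <= 1 -> 0 <= orient u v a -> 0 <= orient u v b ->
  0 <= orient u v (between k a b).
Proof.
by move=> /andP[k0 k1] ha hb; rewrite orient_between addr_ge0 // mulr_ge0 // subr_ge0.
Qed.

(** One coordinate of a barycentric combination with weights [al], [be], [ga] of sum [D], rewritten
    as two successive binary combinations. *)
Lemma barycentre (D al be ga a b c x : R) : D != 0 -> be + ga != 0 ->
  ga + al + be = D -> al * a + be * b + ga * c = D * x ->
  x = (1 - (be + ga) / D) * a +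
      (be + ga) / D * ((1 - ga / (be + ga)) * b + ga / (be + ga) * c).
Proof.
move=> D0 n S e; apply: (mulfI D0); rewrite -e.
have -> : al = D - (be + ga) by lra.
by field; rewrite n D0.
Qed.

(** The three orientations are, up to the factor [orient a b c], the barycentric coordinates of
    [x]. *)
Lemma triangle_hull X a b c x : X a -> X b -> X c -> 0 < orient a b c ->
  0 <= orient a b x -> 0 <= orient b c x -> 0 <= orient c a x -> convex_hull X x.
Proof.
move=> Xa Xb Xc T h1 h2 h3.
have [ha hb hc] : [/\ convex_hull X a, convex_hull X b & convex_hull X c].
  by split; apply: sub_convex_hull.
have S : orient a b x + orient b c x + orient c a x = orient a b c.
  by rewrite /orient; ring.
have e1 : orient b c x * a.1 + orient c a x * b.1 + orient a b x * c.1 = orient a b c * x.1.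
  by rewrite /orient; ring.
have e2 : orient b c x * a.2 + orient c a x * b.2 + orient a b x * c.2 = orient a b c * x.2.
  by rewrite /orient; ring.
set al := orient b c x in h2 S e1 e2 *; set be := orient c a x in h3 S e1 e2 *.
set ga := orient a b x in h1 S e1 e2 *; set D := orient a b c in T S e1 e2.
have D0 : D != 0 by rewrite gt_eqF.
have [z|nz] := eqVneq (be + ga) 0.
  have be0 : be = 0 by lra.
  have ga0 : ga = 0 by lra.
  have alD : al = D by lra.
  rewrite be0 ga0 alD !mul0r !addr0 in e1 e2.
  have -> : x = a; last by [].
  case: x {al be ga h1 h2 h3 S z be0 ga0 alD} e1 e2 => x1 x2 /= /(mulfI D0) <- /(mulfI D0) <-.
  by rewrite -surjective_pairing.
have -> : x = between ((be + ga) / D) a (between (ga / (be + ga)) b c).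
  by rewrite [x in LHS]surjective_pairing; congr pair; apply: barycentre S _.
have p : 0 < be + ga by rewrite lt_def nz addr_ge0.
apply: convex_hull_convex => //.
  by rewrite divr_ge0 ?(ltW p) ?(ltW T) //= ler_pdivrMr // mul1r; lra.
apply: convex_hull_convex => //.
by rewrite divr_ge0 ?(ltW p) //= ler_pdivrMr // mul1r; lra.
Qed.

(** In the fan of triangles from [p], the orientation passes from nonnegative to nonpositive along
    the chain, hence across some link; this selects the triangle for [x]. *)
Lemma fan_triangle p x b t : 0 <= orient p b x -> orient p (last b t) x <= 0 -> t != [::] ->
  exists2 e, e \in links (b :: t) & 0 <= orient p e.1 x /\ orient p e.2 x <= 0.
Proof.
elim: t b => // c t IH b hb hl _.
have [hc|hc] := leP (orient p c x) 0.
  by exists (b, c); rewrite // /links /= mem_head.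
have t0 : t != [::] by case: t hl {IH} => //=; rewrite leNgt hc.
have [e eE h] := IH c (ltW hc) hl t0; exists e => //.
by rewrite /links /= inE; apply/orP; right.
Qed.

Lemma convex_hull_polygon P : polygon P -> convex_hull [set` P] = [set x | inhull P x].
Proof.
move=> pol; apply/seteqP; split.
  apply: convex_hull_min => [k a b k01 /=|x /= xP]; first exact: between_inhull.
  exact: polygon_inhull.
move=> x /= /inhullP hx.
case eP : P (polygon_size pol) => [|p [|b t]] //= /ltnSE t0.
have tn : t != [::] by case: t t0 {eP}.
have eS : sides P = (p, b) :: rcons (links (b :: t)) (last b t, p).
  rewrite eP; case/lastP: t tn {eP t0} => // w y _.
  by rewrite sides_corner last_rcons.
have h1 : 0 <= orient p b x by apply: hx; rewrite eS mem_head.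
have h2 : orient p (last b t) x <= 0.
  rewrite -oppr_ge0 -orient_swap; apply: hx.
  by rewrite eS inE mem_rcons mem_head orbT.
have [[c d] cd [/= hc hd]] := fan_triangle h1 h2 tn.
have cdS : (c, d) \in sides P by rewrite eS inE mem_rcons inE cd !orbT.
have [cP dP] := mem_sides cdS.
have [ct dt] := mem_links cd.
have un := polygon_uniq pol; rewrite eP /= in un; have /andP[pn _] := un.
have pP : p \in P by rewrite eP mem_head.
have o : 0 < orient c d p.
  apply: (side_orient pol cdS pP).
    by apply: contraNneq pn => ->.
  by apply: contraNneq pn => ->.
rewrite -eP; apply: (@triangle_hull _ c d p) => //=; first exact: hx.
  by rewrite orient_swap oppr_ge0.
Qed.
End ConvexSets.

(** * Points in convex position sorted into a polygon *)

Section Sorting.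
Local Open Scope classical_set_scope.
Local Open Scope ring_scope.
Variable R : realType.
Notation pt := (plane R).
Implicit Types (a b c d p q u v x y : pt) (X Y : set pt) (s t P L : seq pt).

Definition extreme_points L := uniq L /\
  forall a, a \in L -> ~ convex_hull [set x | (x \in L) /\ x <> a] a.

Lemma extreme_orient_neq0 L a b c : extreme_points L -> a \in L -> b \in L -> c \in L ->
  a != b -> b != c -> a != c -> orient a b c != 0.
Proof.
move=> [_ ext] aL bL cL ab bc ac; apply/eqP => /(line_between ab)[k e].
have mem x y z k' : x \in L -> y \in L -> z \in L -> x != z -> y != z ->
    0 <= k' <= 1 -> z = between k' x y -> False.
  move=> xL yL zL /eqP xz /eqP yz k01 ez; apply: (ext z zL); rewrite [X in convex_hull _ X]ez.
  by apply: convex_hull_convex => //; apply: sub_convex_hull.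
(* Of three collinear points one lies between the other two: [a], [c] or [b], according to whether
   [k < 0], [0 <= k <= 1] or [k > 1]. *)
have [k0|k0] := ltP k 0.
  apply: (mem b c a (1 / (1 - k))) => //; try by rewrite eq_sym.
    have h : 0 < 1 - k by lra.
    by rewrite divr_ge0 ?(ltW h) //= ler_pdivrMr // mul1r; lra.
  rewrite e /between [a in LHS]surjective_pairing /=.
  by congr pair; field; rewrite subr_eq0 eq_sym lt_eqF // (lt_trans k0).
have [k1|k1] := leP k 1.
  by apply: (mem a b c k) => //; rewrite k0.
apply: (mem a c b (1 / k)) => //; try by rewrite eq_sym.
  by rewrite divr_ge0 //= ler_pdivrMr ?mul1r ?ltW // (lt_trans _ k1).
rewrite e /between [b in LHS]surjective_pairing /=.
by congr pair; field; rewrite gt_eqF // (lt_trans _ k1).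
Qed.

(** Otherwise [b] would lie in the triangle [m a c]. *)
Lemma extreme_triangle L a b c m : extreme_points L ->
  m \in L -> a \in L -> b \in L -> c \in L -> b != m -> b != a -> b != c ->
  0 < orient m a b -> 0 < orient m b c -> 0 < orient m a c -> 0 <= orient a b c.
Proof.
move=> [_ ext] mL aL bL cL bm ba bc h1 h2 h3; rewrite leNgt; apply/negP => o.
apply: (ext b bL); apply: (@triangle_hull _ _ m a c) => //=.
- by split=> // e; rewrite e eqxx in bm.
- by split=> // e; rewrite e eqxx in ba.
- by split=> // e; rewrite e eqxx in bc.
- exact: ltW.
- by rewrite orient_swapr oppr_ge0 ltW.
- by rewrite orient_cycle ltW.
Qed.

Definition lexlt a b := (a.1 < b.1) || (a.1 == b.1) && (a.2 < b.2).

Lemma lexlt_total a b : a != b -> lexlt a b || lexlt b a.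
Proof.
case: a b => [a1 a2] [b1 b2]; rewrite xpair_eqE /lexlt /=.
by case: (ltgtP a1 b1) => //= _; case: (ltgtP a2 b2).
Qed.

Lemma lexlt_trans : transitive lexlt.
Proof.
move=> [b1 b2] [a1 a2] [c1 c2]; rewrite /lexlt /=.
move=> /orP[ab|/andP[/eqP-> ab]] /orP[bc|/andP[/eqP<- bc]]; rewrite ?ab ?bc ?orbT //.
  by rewrite (lt_trans ab bc).
by rewrite eqxx (lt_trans ab bc) orbT.
Qed.

Lemma exists_lexmin L : L != [::] -> uniq L ->
  exists2 m, m \in L & {in L, forall x, x != m -> lexlt m x}.
Proof.
elim: L => // x L IH _ /andP[xL uL].
have [->|L0] := eqVneq L [::].
  by exists x; rewrite ?mem_head // => y; rewrite inE => /eqP->; rewrite eqxx.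
have [m mL hm] := IH L0 uL; have xm : x != m by apply: contraNneq xL => ->.
case/orP: (lexlt_total xm) => h.
  exists x; rewrite ?mem_head // => y; rewrite inE => /orP[/eqP->|yL]; first by rewrite eqxx.
  move=> _; have [->//|ym] := eqVneq y m; exact: lexlt_trans h (hm _ yL ym).
exists m; first by rewrite inE mL orbT.
by move=> y; rewrite inE => /orP[/eqP->//|/hm].
Qed.

(** Seen from the lexicographic minimum, all directions lie in a half-open half-plane, where
    comparing angles is transitive. *)
Lemma lexlt_orient_trans m a b c : lexlt m a -> lexlt m b -> lexlt m c ->
  0 <= orient m a b -> 0 <= orient m b c -> 0 <= orient m a c.
Proof.
case: m a b c => [m1 m2] [a1 a2] [b1 b2] [c1 c2]; rewrite /lexlt /orient /=.
move: (a1 - m1) (subr_gt0 m1 a1) (subr_eq0 a1 m1) (a2 - m2) (subr_gt0 m2 a2) => A1 <- e1 A2 <-.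
move: (b1 - m1) (subr_gt0 m1 b1) (subr_eq0 b1 m1) (b2 - m2) (subr_gt0 m2 b2) => B1 <- e2 B2 <-.
move: (c1 - m1) (subr_gt0 m1 c1) (subr_eq0 c1 m1) (c2 - m2) (subr_gt0 m2 c2) => C1 <- e3 C2 <-.
rewrite ![m1 == _]eq_sym -e1 -e2 -e3.
move=> hA hB hC ab bc.
have A0 : 0 <= A1 by case/orP: hA => [/ltW//|/andP[/eqP-> _]].
have C0 : 0 <= C1 by case/orP: hC => [/ltW//|/andP[/eqP-> _]].
case/orP: hB => [B0|/andP[/eqP eB B2p]].
  by rewrite -(pmulr_rge0 _ B0); nra.
rewrite eB in ab bc; have c0 : C1 = 0.
  by apply/eqP; rewrite eq_le C0 andbT -(pmulr_rle0 _ B2p); lra.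
have C2p : 0 < C2 by move: hC; rewrite c0 ltxx eqxx.
by rewrite c0 mulr0 subr0 mulr_ge0 // ltW.
Qed.

(** Sort by angle around the lexicographic minimum [m]. Triples with [m] are positive by the
    sorting, the others by [extreme_triangle]; strictness holds because no three points are
    collinear. *)
Lemma sort_polygon L : extreme_points L -> (2 < size L)%N ->
  exists2 s, polygon s & perm_eq s L.
Proof.
move=> ext sz; have [uL _] := ext.
have [|m mL hm] := exists_lexmin _ uL; first by case: L sz {ext uL}.
pose r a b := 0 <= orient m a b; pose T := sort r (rem m L).
have pT : perm_eq (m :: T) L.
  by rewrite perm_sym (perm_trans (perm_to_rem mL)) // perm_cons perm_sym perm_sort.
have uT : uniq (m :: T) by rewrite (perm_uniq pT).
have memT x : x \in T -> (x \in L) && (x != m).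
  by rewrite mem_sort mem_rem_uniq // inE andbC.
have r_tot : {in rem m L &, total r}.
  move=> x y _ _; rewrite /r (orient_swapr m y) oppr_ge0.
  exact: le_total.
have r_tr : {in rem m L & &, transitive r}.
  move=> y x z; rewrite !mem_rem_uniq // !inE => /andP[ym yL] /andP[xm xL] /andP[zm zL].
  by apply: lexlt_orient_trans; apply: hm.
have sT : pairwise r T.
  rewrite -(sorted_pairwise_in r_tr); last by apply/allP => x; rewrite mem_sort.
  by apply: (sort_sorted_in r_tot); apply/allP.
have pair a b : subseq [:: a; b] T -> 0 < orient m a b.
  move=> s; have [aT bT] : a \in T /\ b \in T.
    by split; apply: (mem_subseq s); rewrite !inE eqxx ?orbT.
  have /andP[aL am] := memT a aT; have /andP[bL bm] := memT b bT.
  have ab : a != b.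
    have : uniq [:: a; b] by apply: (subseq_uniq s); move: uT => /andP[].
    by rewrite /= inE andbT.
  rewrite lt_def (extreme_orient_neq0 ext) ?[m == _]eq_sym //=.
  by have := subseq_pairwise s sT; rewrite /= !andbT.
exists (m :: T) => //; split; first by rewrite (perm_size pT) sz uT.
move=> a b c; rewrite [subseq _ _]/=; case: eqP => [-> s|_ s]; first exact: pair.
have ab : subseq [:: a; b] T by apply: subseq_trans s; rewrite -[[:: a; b; c]]/([:: a; b] ++ [:: c]) prefix_subseq.
have bc : subseq [:: b; c] T by apply: subseq_trans s; exact: subseq_cons.
have ac : subseq [:: a; c] T.
  apply: subseq_trans s; rewrite -[[:: a; c]]/([:: a] ++ [:: c]) -[[:: a; b; c]]/([:: a] ++ [:: b; c]).
  exact/cat_subseq/subseq_cons.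
have mem x : x \in [:: a; b; c] -> (x \in L) && (x != m) by move=> /(mem_subseq s)/memT.
have /andP[aL am] : (a \in L) && (a != m) by apply: mem; rewrite !inE eqxx.
have /andP[bL bm] : (b \in L) && (b != m) by apply: mem; rewrite !inE eqxx ?orbT.
have /andP[cL cm] : (c \in L) && (c != m) by apply: mem; rewrite !inE eqxx ?orbT.
have : uniq [:: a; b; c] by apply: (subseq_uniq s); move: uT => /andP[].
rewrite /= !inE negb_or andbT => /andP[/andP[nab nac] nbc].
rewrite lt_def (extreme_orient_neq0 ext) //=.
by apply: (extreme_triangle ext mL aL bL cL); rewrite ?pair // eq_sym.
Qed.

Lemma extreme_codom k (v : 'I_k -> pt) : convex_position v -> extreme_points (codom v).
Proof.
move=> cv; have vI : injective v.
  move=> i j e; apply/eqP/negP => /negP ij; apply: (cv i); rewrite e.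
  by apply: sub_convex_hull; exists j => //=; rewrite eq_sym.
split; first by rewrite map_inj_uniq ?enum_uniq.
move=> a /codomP[i ->] h; apply: (cv i); apply: convex_hull_min h.
  by move=> *; apply: convex_hull_convex.
move=> x [/codomP[j ->] ji]; apply: sub_convex_hull; exists j => //=.
by apply/eqP => e; apply: ji; rewrite e.
Qed.

Lemma convex_position_polygon k (v : 'I_k -> pt) : convex_position v -> (2 < k)%N ->
  exists2 s, polygon s & perm_eq s (codom v).
Proof.
by move=> cv k2; apply: sort_polygon; [exact: extreme_codom | rewrite size_codom card_ord].
Qed.
End Sorting.

(** * Interiors of convex polygons *)

Section Topology.
Local Open Scope classical_set_scope.
Local Open Scope ring_scope.
Variable R : realType.
Notation pt := (plane R).
Implicit Types (a b c d p q u v x y : pt) (X Y : set pt) (s t P L : seq pt).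

Lemma orient_continuous u v : continuous (orient u v : pt -> R).
Proof.
move=> x; apply: cvgB; apply: cvgM; try exact: cvg_cst.
  by apply: cvgB; [exact: cvg_snd | exact: cvg_cst].
by apply: cvgB; [exact: cvg_fst | exact: cvg_cst].
Qed.

Lemma open_orient u v : open [set x : pt | 0 < orient u v x].
Proof.
apply: (@open_comp _ _ (orient u v : pt -> R) [set y | 0 < y]); last exact: open_gt.
by move=> x _; exact: orient_continuous.
Qed.

Lemma closed_orient u v : closed [set x : pt | 0 <= orient u v x].
Proof.
apply: (@closed_comp _ _ (orient u v : pt -> R) [set y | 0 <= y]); last exact: closed_ge.
by move=> x _; exact: orient_continuous.
Qed.

Definition inhull_strict P x := all (fun e => 0 < orient e.1 e.2 x) (sides P).

Lemma open_inhull P : open [set x : pt | inhull_strict P x].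
Proof.
rewrite /inhull_strict; elim: (sides P) => [|e E IH].
  by rewrite [X in open X](_ : _ = setT); [exact: openT | apply/seteqP; split].
rewrite [X in open X](_ : _ = [set x | 0 < orient e.1 e.2 x] `&`
  [set x | all (fun e => 0 < orient e.1 e.2 x) E]).
  by apply: openI => //; exact: open_orient.
by apply/seteqP; split=> x /=; [move/andP | move=> h; apply/andP].
Qed.

Lemma closed_inhull P : closed [set x : pt | inhull P x].
Proof.
rewrite /inhull; elim: (sides P) => [|e E IH].
  by rewrite [X in closed X](_ : _ = setT); [exact: closedT | apply/seteqP; split].
rewrite [X in closed X](_ : _ = [set x | 0 <= orient e.1 e.2 x] `&`
  [set x | all (fun e => 0 <= orient e.1 e.2 x) E]).
  by apply: closedI => //; exact: closed_orient.
by apply/seteqP; split=> x /=; [move/andP | move=> h; apply/andP].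
Qed.

Lemma between_continuous a b : continuous (fun k : R => between k a b : pt).
Proof.
have lin (x y : R) : continuous (fun k : R => (1 - k) * x + k * y).
  move=> k; apply: cvgD; apply: cvgM; try exact: cvg_cst; last exact: cvg_id.
  by apply: cvgB; [exact: cvg_cst | exact: cvg_id].
by move=> k; exact: (cvg_pair (lin a.1 b.1 k) (lin a.2 b.2 k)).
Qed.

(** From a point on the line, a small step away from [c] would leave the half-plane but not [X]. *)
Lemma interior_orient X u v c x : (forall y, X y -> 0 <= orient u v y) ->
  0 < orient u v c -> X° x -> 0 < orient u v x.
Proof.
move=> hX hc Xx; rewrite lt_def hX ?andbT; last exact: interior_subset.
apply/eqP => ex.
have : nbhs (0 : R) [set k | X (between k x c)].
  apply: (@between_continuous x c 0).
  by rewrite /= between0.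
move=> /nbhs_ballP[e /= e0 he].
have : X (between (- (e / 2)) x c).
  apply: he; rewrite /ball /= sub0r opprK ger0_norm; last by rewrite divr_ge0 // ltW.
  by rewrite ltr_pdivrMr // ltr_pMr // ltr1n.
move/hX; rewrite orient_between ex mulr0 add0r mulNr oppr_ge0 leNgt mulr_gt0 //.
by rewrite divr_gt0.
Qed.

Lemma polygon_nondeg P u v : polygon P -> u != v -> exists2 c, c \in P & orient u v c != 0.
Proof.
move=> pol uv; have [_ tri] := pol; have := polygon_size pol.
case eP: P => [|a [|b [|c t]]] // _.
have o : 0 < orient a b c by apply: tri; rewrite eP /= !eqxx sub0seq.
have [/eqP ha|] := boolP (orient u v a == 0); last by exists a; rewrite // inE eqxx.
have [/eqP hb|] := boolP (orient u v b == 0); last by exists b; rewrite // !inE eqxx orbT.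
have [/eqP hc|] := boolP (orient u v c == 0); last by exists c; rewrite // !inE eqxx !orbT.
exfalso; move: o => /gt_eqF/eqP; apply.
have [k1 ->] := line_between uv ha; have [k2 ->] := line_between uv hb.
by have [k3 ->] := line_between uv hc; rewrite /orient /between /=; ring.
Qed.

Lemma interior_inhull P : polygon P -> [set x | inhull P x]° = [set x | inhull_strict P x].
Proof.
move=> pol; apply/seteqP; split=> x.
  move=> hx; apply/allP => -[a b] ab /=.
  have [c cP o] := polygon_nondeg pol (side_neq pol ab).
  apply: (interior_orient (c := c) _ _ hx) => [y /= /inhullP|]; first exact.
  by rewrite lt_def o (side_orient_ge0 pol ab cP).
have := @open_inhull P; rewrite openE => h /h; apply: interiorS.
by move=> y /= /allP hy; apply/allP => e /hy/ltW.
Qed.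

Lemma onesided_interior P u v x : polygon P -> u != v -> onesided u v P ->
  inhull_strict P x -> orient u v x != 0.
Proof.
move=> pol uv os hx; have [c cP nc] := polygon_nondeg pol uv.
have hx' : ([set x | inhull P x]° : set pt) x by rewrite interior_inhull.
have key u' v' : {in P, forall y, 0 <= orient u' v' y} -> orient u' v' c != 0 -> 0 < orient u' v' x.
  move=> hP n; apply: (interior_orient (X := [set x | inhull P x]) (c := c)) => //.
    move=> y; rewrite -(convex_hull_polygon pol) => hy.
    apply: (convex_hull_min (Y := [set y | 0 <= orient u' v' y]) _ _ hy) => [k a b|].
      exact: halfplane_convex.
    by move=> z /= /hP.
  by rewrite lt_def n hP.
case/orP: os => /allP h; first by rewrite gt_eqF // key.
rewrite -oppr_eq0 -orient_swap gt_eqF // key //.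
  by move=> y /h /=; rewrite (orient_swap u) oppr_ge0.
by rewrite orient_swap oppr_eq0.
Qed.
End Topology.

(** * Chords of the polygon and edges of the drawing *)

Section Drawing.
Local Open Scope classical_set_scope.
Local Open Scope ring_scope.
Variables (R : realType) (n : nat) (D : rectilinear_drawing R n).
Notation pt := (plane R).
Implicit Types (a b c d p q u v x y z : pt) (X Y : set pt) (P L : seq pt) (i j k : 'I_n).
Implicit Types (e f g : 'I_n * 'I_n).

Lemma closed_segmentP a b z :
  closed_segment a b z <-> exists k : R, 0 <= k <= 1 /\ z = between k a b.
Proof.
split=> [[k]|[k [k01 ->]]].
  by rewrite /= in_itv /= => k01 <-; exists k.
by exists k; rewrite //= in_itv.
Qed.

Lemma open_segmentP a b z :
  open_segment a b z <-> exists k : R, 0 < k < 1 /\ z = between k a b.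
Proof.
split=> [[k]|[k [k01 ->]]].
  by rewrite /= in_itv /= => k01 <-; exists k.
by exists k; rewrite //= in_itv.
Qed.

Lemma closed_segmentl a b : closed_segment a b a.
Proof. by apply/closed_segmentP; exists 0; rewrite between0 lexx ler01. Qed.

Lemma closed_segmentr a b : closed_segment a b b.
Proof. by apply/closed_segmentP; exists 1; rewrite between1 lexx ler01. Qed.

Lemma closed_segmentC a b : closed_segment a b `<=` closed_segment b a.
Proof.
move=> z /closed_segmentP[k [/andP[k0 k1] ->]]; apply/closed_segmentP.
by exists (1 - k); rewrite -betweenC subr_ge0 k1 gerBl k0.
Qed.

(** Two different edges have at least three different ends, and no three vertices are collinear. *)
Lemma edges_no_common_line e f (L : set pt) : edges e -> edges f -> e != f -> is_line L ->
  edge_segment D e `<=` L -> edge_segment D f `<=` L -> False.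
Proof.
case: e f => [i j] [k l] /= ij kl ef lL hi hk.
have [Li Lj] : L (D i) /\ L (D j).
  by split; apply: hi; [exact: closed_segmentl | exact: closed_segmentr].
have [Lk Ll] : L (D k) /\ L (D l).
  by split; apply: hk; [exact: closed_segmentl | exact: closed_segmentr].
have nij : i != j by rewrite -val_eqE /= ltn_eqF.
have nkl : k != l by rewrite -val_eqE /= ltn_eqF.
have gen3 := @vertex_general _ _ D L.
have [ki|nki] := eqVneq k i; have [lj|nlj] := eqVneq l j.
- by move: ef; rewrite ki lj eqxx.
- by apply: (gen3 i j l) => //; rewrite 1?eq_sym //; move: nkl; rewrite ki eq_sym.
- have [kj|nkj] := eqVneq k j; first by move: nkl; rewrite kj lj eqxx.
  by apply: (gen3 i j k) => //; rewrite eq_sym.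
have [kj|nkj] := eqVneq k j; last by apply: (gen3 i j k) => //; rewrite eq_sym.
have [li|nli] := eqVneq l i; last by apply: (gen3 i j l) => //; rewrite eq_sym.
by move: kl; rewrite kj li => ji; have := ltn_trans ij ji; rewrite ltnn.
Qed.

Section Convex.
Variable s : seq pt.
Hypotheses (pol : polygon s) (ps : perm_eq s (codom D)).

Lemma mem_vertex i : D i \in s.
Proof. by rewrite (perm_mem ps) codom_f. Qed.

Lemma vertexP x : x \in s -> exists i, x = D i.
Proof. by rewrite (perm_mem ps) => /codomP[i ->]; exists i. Qed.

Lemma vertex_neq i j : i != j -> D i != D j.
Proof. by apply: contra_neq; apply: vertex_inj. Qed.

Lemma edge_vertex_neq e : edges e -> D e.1 != D e.2.
Proof. by move=> ee; apply: vertex_neq; rewrite -val_eqE /= ltn_eqF. Qed.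

Lemma chord_edge x y : x \in s -> y \in s -> x != y ->
  exists2 e, edges e & (x, y) = (D e.1, D e.2) \/ (x, y) = (D e.2, D e.1).
Proof.
move=> /vertexP[i ->] /vertexP[j ->] ij.
have [lt|lt|e] := ltngtP i j.
- by exists (i, j) => //; left.
- by exists (j, i) => //; right.
- by move: ij; rewrite (val_inj e) eqxx.
Qed.

Lemma inhull_edge e z : edges e -> inhull s z -> orient (D e.1) (D e.2) z = 0 ->
  edge_segment D e z.
Proof.
move=> ee hz o; apply/closed_segmentP.
by have [k [k01 ez]] := inhull_chord pol (mem_vertex _) (mem_vertex _) (edge_vertex_neq ee) hz o; exists k.
Qed.

Lemma segment_edge_interior e z : z \notin s -> edge_segment D e z -> edge_interior D e z.
Proof.
move=> zs /closed_segmentP[k [/andP[k0 k1] ez]]; apply/open_segmentP; exists k; split=> //.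
rewrite !lt_neqAle k0 k1 !andbT; apply/andP; split; apply/negP => /eqP kk; move: zs.
  by rewrite ez -kk between0 mem_vertex.
by rewrite ez kk between1 mem_vertex.
Qed.

Lemma drawing_generic : generic_drawing D -> generic s.
Proof.
move=> gen z e f g hz zs h.
have ed (t : pt * pt) : t \in [:: e; f; g] -> exists2 a, edges a &
    (t = (D a.1, D a.2) \/ t = (D a.2, D a.1)) /\ edge_interior D a z.
  move=> /h[t1 t2 t12 o]; have [a ea et] := chord_edge t1 t2 t12; exists a => //.
  split; first by case: t et {t1 t2 t12 o}.
  apply: segment_edge_interior => //; apply: inhull_edge => //.
  by case: et => -[<- <-] //; rewrite orient_swap o oppr0.
have [a1 ea1 [t1 i1]] : exists2 a, edges a & (e = (D a.1, D a.2) \/ e = (D a.2, D a.1)) /\ edge_interior D a z.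
  by apply: ed; rewrite inE eqxx.
have [a2 ea2 [t2 i2]] : exists2 a, edges a & (f = (D a.1, D a.2) \/ f = (D a.2, D a.1)) /\ edge_interior D a z.
  by apply: ed; rewrite !inE eqxx orbT.
have [a3 ea3 [t3 i3]] : exists2 a, edges a & (g = (D a.1, D a.2) \/ g = (D a.2, D a.1)) /\ edge_interior D a z.
  by apply: ed; rewrite !inE eqxx !orbT.
have same (t t' : pt * pt) (a : 'I_n * 'I_n) : (t = (D a.1, D a.2) \/ t = (D a.2, D a.1)) ->
    (t' = (D a.1, D a.2) \/ t' = (D a.2, D a.1)) -> same_chord t t'.
  by rewrite /same_chord; case=> -> [] -> /=; rewrite eqxx ?orbT.
have [e12|n12] := eqVneq a1 a2; first by rewrite (same e f a1) // e12.
have [e23|n23] := eqVneq a2 a3; first by rewrite (same f g a2) ?orbT // e23.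
have [e13|n13] := eqVneq a1 a3; first by rewrite (same e g a1) ?orbT // e13.
exfalso; apply: (gen z); exists a1, a2, a3; split.
  by split=> //=; rewrite !inE negb_or n12 n13 n23.
by split; split=> // -[L [lL h1 h2]]; [apply: (@edges_no_common_line a1 a2 L)
  | apply: (@edges_no_common_line a2 a3 L) | apply: (@edges_no_common_line a1 a3 L)].
Qed.

Lemma between_closed_segment (k : R) a b x y : 0 <= k <= 1 ->
  closed_segment x y a -> closed_segment x y b -> closed_segment x y (between k a b).
Proof.
move=> /andP[k0 k1] /closed_segmentP[ka [/andP[a0 a1] ->]] /closed_segmentP[kb [/andP[b0 b1] ->]].
apply/closed_segmentP; exists ((1 - k) * ka + k * kb); split.
  have k1' : 0 <= 1 - k by rewrite subr_ge0.
  rewrite addr_ge0 ?mulr_ge0 //=; have := ler_wpM2l k1' a1; have := ler_wpM2l k0 b1; lra.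
by rewrite /between /=; congr pair; ring.
Qed.

Section Face.
Variables (F : seq (seq pt)) (ds : seq (pt * pt)) (P : seq pt).
Hypothesis dis : dissection s F ds.
Hypothesis cov : all_chords s ds.
Hypothesis hds : {in ds, forall t : pt * pt, [/\ t.1 \in s, t.2 \in s & t.1 != t.2]}.
Hypothesis PF : P \in F.

Lemma face_chord (t : pt * pt) : t \in sides s ++ ds ->
  [/\ t.1 \in s, t.2 \in s, t.1 != t.2 & onesided t.1 t.2 P].
Proof.
have [_ done_ dhull _ _ _] := dis; rewrite mem_cat => /orP[ts|td]; last first.
  by have [h1 h2 h3] := hds td; split=> //; apply: done_.
case: t ts => a b ab; have [as_ bs] := mem_sides ab; split=> //; first exact: side_neq ab.
by apply/orP; left; apply/allP => x /(dhull _ PF)/inhullP; apply.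
Qed.

(** Every edge is a chord of the dissection, and the face lies on one side of each chord; its
    interior therefore avoids the lines of all edges. *)
Lemma face_off_drawing x : (1 < n)%N -> inhull_strict P x -> ~ drawing_set D x.
Proof.
move=> n1 hx; have polP := dis_polygon dis PF.
have off i j : i != j -> orient (D i) (D j) x != 0.
  move=> ij; case/orP: (cov (mem_vertex i) (mem_vertex j) (vertex_neq ij)) => /face_chord[/= _ _ nij os].
    exact: (onesided_interior polP).
  by rewrite -oppr_eq0 -orient_swap; apply: (onesided_interior polP).
case=> [[i _ ex]|[[i j] /= ij /closed_segmentP[k [_ ex]]]].
  (* A second vertex puts the vertex [D i] on the line of an edge. *)
  have [j ij] : exists j, i != j.
    have : (0 < #|predC1 i|)%N by rewrite cardC1 card_ord -subn1 subn_gt0.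
    by case/card_gt0P => j; rewrite inE eq_sym => h; exists j.
  by have := off _ _ ij; rewrite -ex orient_aba eqxx.
have nij : i != j by rewrite -val_eqE /= ltn_eqF.
by have := off _ _ nij; rewrite ex orient_between orient_aba orient_baa !mulr0 addr0 eqxx.
Qed.

(** A boundary point lies on a side of the face, and by [dis_line] this side is part of a chord. *)
Lemma face_boundary x : inhull P x -> ~~ inhull_strict P x -> drawing_set D x.
Proof.
move=> hx; rewrite /inhull_strict -has_predC => /hasP[[a b] ab /= nab].
have polP := dis_polygon dis PF; have [aP bP] := mem_sides ab.
have o : orient a b x = 0.
  by apply/eqP; rewrite eq_le leNgt nab; move/inhullP: hx; apply.
have [k [k01 ex]] := inhull_chord polP aP bP (side_neq polP ab) hx o.
have abF : (a, b) \in allsides F by apply/flattenP; exists (sides P) => //; apply: map_f.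
have [[u v] /face_chord[/= us vs uv _] [/= ha hb]] := dis_line dis abF.
right; have [e ee et] := chord_edge us vs uv; exists e => //.
have hull := dis_inhull dis PF.
have on c : c \in P -> orient u v c = 0 -> edge_segment D e c.
  move=> cP oc; apply: inhull_edge => //; first exact: hull.
  by case: et => -[<- <-] //; rewrite orient_swap oc oppr0.
by rewrite ex; apply: between_closed_segment => //; apply: on.
Qed.
End Face.
End Convex.
End Drawing.

(** * The polygons of the dissection are faces of the drawing *)

Section PolygonFaces.
Local Open Scope classical_set_scope.
Local Open Scope ring_scope.
Variable R : realType.
Notation pt := (plane R).
Implicit Types (a b c d p q u v x y z : pt) (X Y : set pt) (P L s : seq pt).

(** A combination of three corners with positive weights works, since the line of a side contains at
    most two of them. *)
Lemma inhull_strict_nonempty P : polygon P -> exists x, inhull_strict P x.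
Proof.
move=> pol; have := polygon_size pol; have := polygon_uniq pol.
case eP: P => [|a [|b [|c t]]] //= /and3P[]; rewrite !inE !negb_or.
move=> /and3P[ab ac _] /andP[bc _] _ _.
exists (between (1 / 2) (between (1 / 2) a b) c); rewrite -eP; apply/allP => -[p q] pq.
have [aP bP cP] : [/\ a \in P, b \in P & c \in P] by rewrite eP !inE !eqxx !orbT.
have ge := side_orient_ge0 pol pq; have := ge _ aP; have := ge _ bP; have := ge _ cP.
have gt := side_orient pol pq; move=> hc hb ha; rewrite !orient_between /=.
have [pa|na] := boolP ((a == p) || (a == q)); last first.
  by move: na; rewrite negb_or => /andP[n1 n2]; have := gt _ aP n1 n2; lra.
have [pb|nb] := boolP ((b == p) || (b == q)); last first.
  by move: nb; rewrite negb_or => /andP[n1 n2]; have := gt _ bP n1 n2; lra.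
have /andP[n1 n2] : (c != p) && (c != q).
  move: pa pb => /orP[] /eqP ea /orP[] /eqP eb; move: ab ac bc;
  by rewrite ea eb ?eqxx // => _; rewrite eq_sym => -> ; rewrite eq_sym => ->.
by have := gt _ cP n1 n2; lra.
Qed.

Lemma inhull_strict_between P k a b : 0 <= k <= 1 -> inhull_strict P a -> inhull_strict P b ->
  inhull_strict P (between k a b).
Proof.
move=> /andP[k0 k1] /allP ha /allP hb; apply/allP => e eP; rewrite /= orient_between.
have := ha _ eP; have := hb _ eP => /= h1 h2.
have [->|kn] := eqVneq k 0; first by rewrite subr0 mul1r mul0r addr0.
by apply: convex_comb_gt0 => //; [rewrite lt_def kn | exact: ltW].
Qed.

Lemma segment_in_component X x y : (forall k, 0 <= k <= 1 -> X (between k x y)) ->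
  connected_component X x y.
Proof.
move=> hX; pose f k := between k x y.
apply: (@connected_component_max _ X (f @` `[0, 1]%classic)).
- by exists 0; rewrite /f ?between0 //= in_itv /= lexx ler01.
- by move=> z [k]; rewrite /= in_itv /= => k01 <-; exact: hX.
- apply: connected_continuous_connected; first exact: segment_connected.
  by apply: continuous_subspaceT; exact: between_continuous.
- by exists 1; rewrite /f ?between1 //= in_itv /= lexx ler01.
Qed.

(** On [X] the open [Y] and the closed [Z] coincide, so [Y] meets the component in a relatively open
    and closed part. *)
Lemma component_clopen X Y Z x : open Y -> closed Z -> Y `<=` Z ->
  (forall y, Z y -> ~ Y y -> ~ X y) -> Y x -> X x ->
  connected_component X x `<=` Y.
Proof.
move=> oY cZ YZ ZY Yx Xx; set T := connected_component X x.
have Tx : T x by exact: connected_component_refl.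
have TX : T `<=` X by exact: connected_component_sub.
have e : T `&` Y = T `&` Z.
  apply/seteqP; split=> y [Ty hy]; split=> //; first exact: YZ.
  by apply: contrapT => nY; apply: (ZY y hy nY); exact: TX.
have <- : T `&` Y = T by apply: (@component_connected _ X x); [exists x | exists Y | exists Z].
by move=> y [].
Qed.

Lemma bounded_inhull P : polygon P -> bounded_set [set x | inhull P x].
Proof.
move=> pol; rewrite -(convex_hull_polygon pol).
have [M [M0 hM]] : exists M, 0 <= M /\ {in P, forall x, `|x.1| <= M /\ `|x.2| <= M}.
  elim: (P) => [|a L [M [M0 hM]]]; first by exists 0.
  exists (M + `|a.1| + `|a.2|); split=> [|x]; first by rewrite !addr_ge0.
  rewrite inE => /orP[/eqP->|/hM[h1 h2]]; have := normr_ge0 a.1; have := normr_ge0 a.2; split; lra.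
suff sub : convex_hull [set` P] `<=` [set x | `|x.1| <= M /\ `|x.2| <= M].
  exists M; split; first exact: num_real.
  move=> K MK x /sub[h1 h2]; apply: le_trans (ltW MK).
  by rewrite prod_normE /= ge_max h1 h2.
apply: convex_hull_min => [k a b /andP[k0 k1] /= [a1 a2] [b1 b2]|x /hM //].
have k1' : 0 <= 1 - k by rewrite subr_ge0.
split; apply: (le_trans (ler_normD _ _)); rewrite !normrM (ger0_norm k0) (ger0_norm k1').
  have := ler_wpM2l k1' a1; have := ler_wpM2l k0 b1; lra.
have := ler_wpM2l k1' a2; have := ler_wpM2l k0 b2; lra.
Qed.

(** The line through the two neighbours of a corner separates it from all other corners. *)
Lemma polygon_convex_polygon P : polygon P -> convex_polygon (size P) [set x | inhull P x].
Proof.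
move=> pol; split; first exact: polygon_size.
pose v (i : 'I_(size P)) := nth 0 P i; exists v; split; last first.
  rewrite -(convex_hull_polygon pol); congr convex_hull.
  apply/seteqP; split=> x /=.
    by move=> xP; have xi := xP; rewrite -index_mem in xi; exists (Ordinal xi); rewrite // /v nth_index.
  by move=> [i _ <-]; rewrite /v mem_nth.
move=> i; have iP : v i \in P by rewrite mem_nth.
have [k [z [w [y e]]]] := corner_at pol iP; have [_ tri] := polygon_rot k pol.
rewrite e in tri.
have o : 0 < orient (v i) z y.
  by apply: tri; rewrite /= !eqxx sub1seq mem_rcons mem_head.
have sub : convex_hull (v @` [set j | j != i]) `<=` [set x | 0 <= orient y z x].
  apply: convex_hull_min => [k' a b|x [j ji <-]] /=; first exact: halfplane_convex.
  have jP : v j \in P by rewrite mem_nth.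
  have ji' : v j != v i by rewrite nth_uniq ?polygon_uniq //.
  move: jP; rewrite -(mem_rot k P) e !inE mem_rcons !inE (negPf ji') /= => /or3P[/eqP->|/eqP->|jw].
  - by rewrite orient_baa.
  - by rewrite orient_aba.
  rewrite orient_cycle ltW //; apply: tri; apply: subseq_trans (subseq_cons _ _).
  by rewrite /= eqxx -cats1 subseq_mem2 // mem_head.
have e' : orient y z (v i) = - orient (v i) z y by rewrite /orient; ring.
by move=> /sub /=; rewrite e' oppr_ge0 leNgt o.
Qed.

Lemma face_kface (n : nat) (D : rectilinear_drawing R n) s F ds P : (1 < n)%N ->
  polygon s -> perm_eq s (codom D) -> dissection s F ds -> all_chords s ds ->
  {in ds, forall t : pt * pt, [/\ t.1 \in s, t.2 \in s & t.1 != t.2]} ->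
  P \in F -> is_kface D (size P) [set x | inhull_strict P x].
Proof.
move=> n1 pol ps dis cov hds PF; have polP := dis_polygon dis PF.
have off x : inhull_strict P x -> (~` drawing_set D) x.
  exact: (face_off_drawing pol ps dis cov hds PF n1).
have [x0 hx0] := inhull_strict_nonempty polP.
split.
- exists x0; split; first exact: off.
  apply/seteqP; split=> [y hy|].
    apply: segment_in_component => k k01; apply: off; exact: inhull_strict_between.
  apply: (@component_clopen _ _ [set x | inhull P x]) => //.
  + exact: open_inhull.
  + exact: closed_inhull.
  + by rewrite -interior_inhull //; exact: interior_subset.
  + move=> y hy /negP ny; apply; exact: (face_boundary pol ps dis hds PF hy ny).
  + exact: off.
- have [M [Mr hM]] := bounded_inhull polP; exists M; split=> // K MK x hx.
  by apply: (hM K MK); move: hx; rewrite -interior_inhull //; exact: interior_subset.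
- exists [set x | inhull P x]; split; first exact: polygon_convex_polygon.
  by rewrite interior_inhull.
Qed.
End PolygonFaces.

(** * Corners of a face, and drawings with at most four vertices *)

Section Converse.
Local Open Scope classical_set_scope.
Local Open Scope ring_scope.
Variables (R : realType) (n : nat) (D : rectilinear_drawing R n).
Notation pt := (plane R).
Implicit Types (a b c d p q u v x y z : pt) (X Y : set pt) (P L s t : seq pt).

Lemma closed_closed_segment a b : closed (closed_segment a b).
Proof.
apply: compact_closed; first exact: norm_hausdorff.
apply: continuous_compact; last exact: segment_compact.
by apply: continuous_subspaceT; exact: between_continuous.
Qed.

Lemma nbhs_all (I : eqType) (r : seq I) (Q : I -> set pt) c :
  {in r, forall i, nbhs c (Q i)} -> nbhs c [set y | forall i, i \in r -> Q i y].
Proof.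
elim: r => [|i r IH] h; first by apply: (@filterS _ _ _ setT) => //; exact: filterT.
have hi := h _ (mem_head _ _); have hr := IH (fun k kr => h k (mem_behead (s := i :: r) kr)).
apply: filterS (filterI hi hr) => y [h1 h2] k.
by rewrite inE => /orP[/eqP->|/h2].
Qed.

Lemma nbhs_avoid c : nbhs c [set y | (forall i, D i <> c -> D i <> y) /\
  (forall e, ~ edge_segment D e c -> ~ edge_segment D e y)].
Proof.
have h1 : nbhs c [set y | forall i, i \in enum 'I_n -> D i <> c -> D i <> y].
  apply: nbhs_all => i _; have [->|n0] := pselect (D i = c).
    by apply: (@filterS _ _ _ setT) => //; exact: filterT.
  have nc : nbhs c (~` [set D i]).
    apply: open_nbhs_nbhs; split; last by move=> e; apply: n0.
    apply: closed_openC; apply: accessible_closed_set1.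
    by apply: hausdorff_accessible; exact: norm_hausdorff.
  by apply: filterS nc => y ny _ e; apply: ny.
have h2 : nbhs c [set y | forall e, e \in enum {: 'I_n * 'I_n} ->
    ~ edge_segment D e c -> ~ edge_segment D e y].
  apply: nbhs_all => e _; have [ec|n0] := pselect (edge_segment D e c).
    by apply: (@filterS _ _ _ setT) => //; exact: filterT.
  have nc : nbhs c (~` edge_segment D e).
    by apply: open_nbhs_nbhs; split => //; exact/closed_openC/closed_closed_segment.
  by apply: filterS nc => y ny _.
apply: filterS (filterI h1 h2) => y [g1 g2]; split=> [i|e].
  by apply: g1; rewrite mem_enum.
by apply: g2; rewrite mem_enum.
Qed.

Lemma nbhs_between c b (U : set pt) : nbhs c U ->
  exists k : R, [/\ 0 < k, k <= 1, U (between k c b) & U (between (- k) c b)].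
Proof.
move=> Uc; have : nbhs (0 : R) [set k | U (between k c b)].
  by apply: (@between_continuous _ c b 0); rewrite /= between0.
move=> /nbhs_ballP[e /= e0 he].
pose k := Num.min 1 (e / 2).
have k0 : 0 < k by rewrite lt_min ltr01 divr_gt0.
have ke : k < e by rewrite gt_min ltr_pdivrMr // ltr_pMr ?ltr1n ?orbT.
exists k; split=> //; first by rewrite ge_min lexx.
  by apply: he; rewrite /ball /= sub0r normrN gtr0_norm.
by apply: he; rewrite /ball /= sub0r opprK gtr0_norm.
Qed.

(** If [x < 0], the parameter [- x / (2 * (y - x))] gives the value [x / 2]. *)
Lemma ge0_limit (x y : R) : (forall k, 0 < k <= 1 -> 0 <= (1 - k) * x + k * y) -> 0 <= x.
Proof.
move=> h; rewrite leNgt; apply/negP => x0.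
have y0 : 0 <= y by have := h 1; rewrite ltr01 lexx subrr mul0r add0r mul1r; apply.
have d0 : 0 < 2 * (y - x) by lra.
have := h (- x / (2 * (y - x))); rewrite divr_gt0 ?oppr_gt0 //= ler_pdivrMr // mul1r.
have -> : (1 - - x / (2 * (y - x))) * x + - x / (2 * (y - x)) * y = x / 2.
  by field; rewrite gt_eqF // subr_gt0 (lt_le_trans x0).
have -> : - x <= 2 * (y - x) by lra.
by move=> /(_ isT); lra.
Qed.

Lemma prod_ball_between (c x y : pt) (e k : R) : 0 <= k <= 1 ->
  ball c e x -> ball c e y -> ball c e (between k x y).
Proof.
move=> /andP[k0 k1] [x1 x2] [y1 y2]; have k1' : 0 <= 1 - k by rewrite subr_ge0.
have H (a b d : R) : `|a - b| < e -> `|a - d| < e -> `|a - ((1 - k) * b + k * d)| < e.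
  have [->|kn] := eqVneq k 0; first by rewrite subr0 mul1r mul0r addr0.
  have kp : 0 < k by rewrite lt_def kn.
  rewrite !ltr_norml => /andP[h1 h2] /andP[h3 h4].
  have := @convex_comb_gt0 _ k (e - (a - b)) (e - (a - d)) kp k1.
  have := @convex_comb_gt0 _ k (e + (a - b)) (e + (a - d)) kp k1.
  rewrite ?subr_ge0 ?(ltW h2) ?subr_gt0 ?h4 => p1 p2; apply/andP; split.
    have : 0 <= e + (a - b) by lra.
    by move=> /p1; have : 0 < e + (a - d) by [lra] => q /(_ q); lra.
  by have := p2 isT isT; lra.
by split; apply: H.
Qed.

Section Corner.
Variable t : seq pt.
Hypothesis pol : polygon t.
Variable x0 : pt.
Hypothesis face : connected_component (~` drawing_set D) x0 = [set x | inhull_strict t x].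

Lemma inhull_strict_mix (k : R) a b : 0 <= k < 1 -> inhull_strict t a -> inhull t b ->
  inhull_strict t (between k a b).
Proof.
move=> /andP[k0 k1] /allP ha /allP hb; apply/allP => e eP; rewrite /= orient_between.
have := ha _ eP; have := hb _ eP => /= h1 h2.
have -> : (1 - k) * orient e.1 e.2 a + k * orient e.1 e.2 b =
  (1 - (1 - k)) * orient e.1 e.2 b + (1 - k) * orient e.1 e.2 a by ring.
by apply: convex_comb_gt0 => //; rewrite ?subr_gt0 // gerBl.
Qed.

(** Otherwise the drawing near [c] lies in a single line [cb]. Segments from a nearby point of the
    face to the points of this line around [c] stay in the face up to their ends, so the closed face
    contains points of the line on both sides of [c]. For a corner this is possible only if both its
    sides lie along this line. *)
Lemma corner_cases c : c \in t -> (exists i, c = D i) \/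
  exists e f, [/\ edges e, edges f, e != f & edge_segment D e c /\ edge_segment D f c].
Proof.
move=> ct; apply: contrapT => /not_orP[nV nX].
have nV' i : D i <> c by move=> h; apply: nV; exists i.
have [b [bc hb]] : exists b, b != c /\ forall e y, edges e -> edge_segment D e c ->
    edge_segment D e y -> orient c b y = 0.
  have [[e [ee ec]]|none] := pselect (exists e, edges e /\ edge_segment D e c); last first.
    (* With no edge through [c], any direction serves. *)
    exists (c.1 + 1, c.2); split.
      by case: (c) => c1 c2; rewrite xpair_eqE /= -subr_eq0 addrC addKr oner_eq0.
    by move=> e y ee ec; exfalso; apply: none; exists e.
  exists (D e.1); split; first by apply/eqP; apply: nV'.
  move=> f y ef fc; have -> : f = e.
    by apply/eqP; apply: contrapT => /negP nfe; apply: nX; exists f, e.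
  move=> /closed_segmentP[k [_ ->]]; have /closed_segmentP[k' [_ ->]] := ec.
  by rewrite /orient /between /=; ring.
have [x [hx ox]] : exists x, inhull_strict t x /\ orient c b x != 0.
  have [z hz] := inhull_strict_nonempty pol.
  (* An interior point on the line is moved halfway towards a corner off the line. *)
  have [oz|nz] := eqVneq (orient c b z) 0; last by exists z.
  have cb : c != b by rewrite eq_sym.
  have [a aP oa] := polygon_nondeg pol cb.
  exists (between (1 / 2) z a); split.
    apply: inhull_strict_mix => //; last exact: polygon_inhull.
    by apply/andP; split; lra.
  by rewrite orient_between oz mulr0 add0r mulf_neq0 //; lra.
have := nbhs_avoid c => /nbhs_ballP[e /= e0 avoid].
have ce : nbhs c (ball c e) by apply: nbhsx_ballx.
have [k [k0 k1 xb _]] := nbhs_between x ce.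
have [r [r0 r1 bp bm]] := nbhs_between b ce.
set x' := between k c x in xb.
have hx' : inhull_strict t x'.
  rewrite /x' betweenC; apply: inhull_strict_mix => //; last exact: polygon_inhull.
  by rewrite subr_ge0 k1 gtrBl.
have ox' : orient c b x' != 0 by rewrite orient_between orient_aba mulr0 add0r mulf_neq0 // gt_eqF.
have off z m : ball c e z -> orient c b z = 0 -> 0 < m <= 1 -> (~` drawing_set D) (between m z x').
  move=> hz oz /andP[m0 m1]; have m01 : 0 <= m <= 1 by rewrite ltW.
  have [h1 h2] := avoid _ (prod_ball_between m01 hz xb).
  move=> [[i _ ei]|[f ef fz]]; first exact: (h1 i (nV' i) ei).
  have [fc|nfc] := pselect (edge_segment D f c); last exact: (h2 f nfc fz).
  have := hb f _ ef fc fz; rewrite orient_between oz mulr0 add0r => /eqP.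
  by rewrite mulf_eq0 (negPf ox') gt_eqF.
have inP z u v : ball c e z -> orient c b z = 0 -> (u, v) \in sides t -> 0 <= orient u v z.
  move=> hz oz uv; apply: (@ge0_limit _ (orient u v x')) => m /andP[m0 m1].
  rewrite -orient_between; suff : inhull_strict t (between m z x') by move=> /allP/(_ _ uv)/ltW.
  suff : connected_component (~` drawing_set D) x' (between m z x').
    rewrite -(_ : connected_component (~` drawing_set D) x0 = connected_component (~` drawing_set D) x').
      by rewrite face.
    by apply: same_connected_component; rewrite face.
  apply: segment_in_component => l /andP[l0 l1].
  have -> : between l x' (between m z x') = between (1 - l * (1 - m)) z x'.
    by rewrite /between /=; congr pair; ring.
  apply: off => //; have : 0 <= l * (1 - m) by rewrite mulr_ge0 // subr_ge0.
  have : l * (1 - m) < 1.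
    have [->|ln] := eqVneq l 0; first by rewrite mul0r.
    rewrite (le_lt_trans (ler_wpM2r _ l1)) ?subr_ge0 // mul1r; lra.
  by move=> q1 q2; apply/andP; split; lra.
have on (l : R) : orient c b (between l c b) = 0 by rewrite orient_between orient_aba orient_baa !mulr0 addr0.
(* Along the line [cb], the affine function [orient u v] vanishes at [c] and is nonnegative on both
   sides of it. *)
have zero u v : (u, v) \in sides t -> orient u v c = 0 -> orient u v b = 0.
  move=> uv oc; have := inP _ _ _ bp (on _) uv; have := inP _ _ _ bm (on _) uv.
  rewrite !orient_between oc !mulr0 !add0r mulNr oppr_ge0 pmulr_rle0 // pmulr_rge0 // => h1 h2.
  by apply/eqP; rewrite eq_le h1 h2.
have [p [q [pc cq o]]] := polygon_corner pol ct.
move/eqP: bc; apply; apply: (@lines_meet _ p c q).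
- by rewrite gt_eqF.
- by apply: zero => //; rewrite orient_baa.
- by apply: zero => //; rewrite orient_aba.
Qed.
End Corner.

(** [orient a b] is nonnegative at both ends of the chord and vanishes strictly between them, hence
    at both ends. *)
Lemma crossing_not_side s (a b x y c : pt) : polygon s -> (a, b) \in sides s ->
  x \in s -> y \in s -> x != y -> c \notin s -> orient a b c = 0 -> closed_segment x y c ->
  (x, y) = (a, b) \/ (x, y) = (b, a).
Proof.
move=> pol ab xs ys xy cs oc /closed_segmentP[k [/andP[k0 k1] ec]].
have kn0 : k != 0 by apply: contraNneq cs => e; rewrite ec e between0.
have kn1 : k != 1 by apply: contraNneq cs => e; rewrite ec e between1.
have kp : 0 < k by rewrite lt_def kn0.
have kp' : 0 < 1 - k by rewrite subr_gt0 lt_neqAle kn1.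
have [as_ bs] := mem_sides ab.
have hx := side_orient_ge0 pol ab xs; have hy := side_orient_ge0 pol ab ys.
have := oc; rewrite ec orient_between => e.
have p1 := mulr_ge0 (ltW kp') hx; have p2 := mulr_ge0 (ltW kp) hy.
have /eqP : (1 - k) * orient a b x = 0 by lra.
have /eqP : k * orient a b y = 0 by lra.
rewrite !mulf_eq0 (gt_eqF kp) (gt_eqF kp') /= => /eqP oy /eqP ox.
exact: (chord_unique pol as_ bs xs ys (side_neq pol ab) xy ox oy).
Qed.

Lemma quad_diagonal (p q r w x y : pt) : x \in [:: p; q; r; w] -> y \in [:: p; q; r; w] ->
  x != y -> ((x, y) \notin sides [:: p; q; r; w]) && ((y, x) \notin sides [:: p; q; r; w]) ->
  [\/ (x, y) = (p, r), (x, y) = (r, p), (x, y) = (q, w) | (x, y) = (w, q)].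
Proof.
move=> xs ys xy ns; move: xs ys; rewrite !inE => /or4P[] /eqP ex /or4P[] /eqP ey; move: xy ns;
rewrite /sides /= !inE ex ey ?eqxx ?orbT ?andbF //= => _ _.
- by constructor 1.
- by constructor 3.
- by constructor 2.
- by constructor 4.
Qed.

Lemma triangle_diagonal (p q r x y : pt) : x \in [:: p; q; r] -> y \in [:: p; q; r] ->
  x != y -> ((x, y) \notin sides [:: p; q; r]) && ((y, x) \notin sides [:: p; q; r]) -> False.
Proof.
move=> xs ys xy ns; move: xs ys; rewrite !inE => /or3P[] /eqP ex /or3P[] /eqP ey; move: xy ns;
by rewrite /sides /= !inE ex ey ?eqxx ?orbT ?andbF //=.
Qed.

Lemma two_crossing_chords s (x y x' y' c : pt) : polygon s -> (size s <= 4)%N ->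
  x \in s -> y \in s -> x' \in s -> y' \in s -> x != y -> x' != y' -> c \notin s ->
  (x', y') <> (x, y) -> (x', y') <> (y, x) ->
  closed_segment x y c -> closed_segment x' y' c ->
  exists p q r w, [/\ s = [:: p; q; r; w], closed_segment p r c & closed_segment q w c].
Proof.
move=> pol s4 xs ys xs' ys' xy xy' cs n1 n2 h h'.
have on a b : closed_segment a b c -> orient a b c = 0.
  move=> /closed_segmentP[k [_ ->]].
  by rewrite orient_between orient_aba orient_baa !mulr0 addr0.
have onC a b : closed_segment a b c -> orient b a c = 0.
  by move=> /closed_segmentC/on.
have flip a b a' b' : (a, b) = (a', b') :> pt * pt -> (b, a) = (b', a') by case=> -> ->.
have ns : ((x, y) \notin sides s) && ((y, x) \notin sides s).
  apply/andP; split; apply/negP => ab.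
    by case: (crossing_not_side pol ab xs' ys' xy' cs (on _ _ h) h').
  by case: (crossing_not_side pol ab xs' ys' xy' cs (onC _ _ h) h').
have ns' : ((x', y') \notin sides s) && ((y', x') \notin sides s).
  apply/andP; split; apply/negP => ab.
    case: (crossing_not_side pol ab xs ys xy cs (on _ _ h') h) => -[ex ey].
      by apply: n1; rewrite ex ey.
    by apply: n2; rewrite ex ey.
  case: (crossing_not_side pol ab xs ys xy cs (onC _ _ h') h) => -[ex ey].
    by apply: n2; rewrite ex ey.
  by apply: n1; rewrite ex ey.
have := polygon_size pol; case es: s s4 => [|p [|q [|r [|w [|? ?]]]]] // _ _.
  by rewrite es in xs ys ns; case: (triangle_diagonal xs ys xy ns).
rewrite es in xs ys xs' ys' ns ns'; exists p, q, r, w.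
have d1 := quad_diagonal xs ys xy ns; have d2 := quad_diagonal xs' ys' xy' ns'.
have hC := closed_segmentC h; have hC' := closed_segmentC h'.
case: d1 => -[ex ey]; case: d2 => -[ex' ey']; subst x y x' y'; (try by split); exfalso;
  by [apply: n1 | apply: n2].
Qed.

(** [orient q w] has opposite signs at [p] and [r], so it vanishes for only one parameter along
    [pr]. *)
Lemma quad_crossing_unique (p q r w c c' : pt) : polygon [:: p; q; r; w] ->
  closed_segment p r c -> closed_segment q w c -> closed_segment p r c' -> closed_segment q w c' ->
  c = c'.
Proof.
move=> pol; have [_ tri] := pol.
have A : 0 < orient q w p.
  rewrite -orient_cycle; apply: tri.
  by apply: (@cat_subseq _ [:: p; q] [:: w] [:: p; q] [:: r; w]); rewrite ?subseq_refl ?subseq_cons.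
have B : 0 < orient q r w by apply: tri; exact: subseq_cons.
rewrite -[orient q r w]opprK -orient_swapr oppr_gt0 in B.
have on (l : R) z : z = between l p r -> closed_segment q w z ->
    (1 - l) * orient q w p + l * orient q w r = 0.
  move=> -> /closed_segmentP[m [_ e]]; rewrite -orient_between e.
  by rewrite orient_between orient_aba orient_baa !mulr0 addr0.
move=> /closed_segmentP[k [_ e]] h /closed_segmentP[k' [_ e']] h'.
have := on _ _ e h; have := on _ _ e' h' => E' E.
suff kk : k = k' by rewrite e e' kk.
have d : orient q w r - orient q w p != 0 by rewrite lt_eqF //; lra.
by apply: (mulIf d); lra.
Qed.
End Converse.

(** * The two directions of the equivalence *)

Section Final.
Local Open Scope classical_set_scope.
Local Open Scope ring_scope.
Variables (R : realType) (n : nat) (D : rectilinear_drawing R n).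
Notation pt := (plane R).
Hypothesis hconv : convex_drawing D.

Lemma pentagon_face_vertices (F : set pt) : is_kface D 5 F -> (5 <= n)%N.
Proof.
case=> -[x0 [hx0 eF]] _ [P [[_ [v [cv eP]]] eF']].
have [t polt pt_] := convex_position_polygon cv isT.
have ePt : P = [set x | inhull t x].
  rewrite eP -(convex_hull_polygon polt); congr convex_hull; apply/seteqP; split=> x.
    by move=> [i _ <-] /=; rewrite (perm_mem pt_) codom_f.
  by rewrite /= (perm_mem pt_) => /codomP[i ->]; exists i.
have face : connected_component (~` drawing_set D) x0 = [set x | inhull_strict t x].
  by rewrite -eF eF' ePt interior_inhull.
have szt : size t = 5%N by rewrite (perm_size pt_) size_codom card_ord.
have corner := corner_cases polt face.
have unt := polygon_uniq polt.
rewrite leqNgt; apply/negP => n5.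
have szV : size (codom D) = n by rewrite size_codom card_ord.
(* At most two vertices do not allow two different edges, so every corner of the face is a
   vertex. *)
have [n2|n2] := leqP n 2.
  have sub : {subset t <= codom D}.
    move=> c ct; case: (corner c ct) => [[i ->]|[[i j] [[k l] [/= ij kl ef _]]]].
      exact: codom_f.
    exfalso; move/eqP: ef; apply; have jn := ltn_ord j; have ln := ltn_ord l.
    have ij' : (i < j)%N := ij; have kl' : (k < l)%N := kl.
    by congr pair; apply: ord_inj; move: ij' kl' jn ln n2;
      move: (nat_of_ord i) (nat_of_ord j) (nat_of_ord k) (nat_of_ord l); clear; lia.
  by have := uniq_leq_size unt sub; rewrite szt szV; lia.
have [s pol ps] := convex_position_polygon hconv n2.
have szs : size s = n by rewrite (perm_size ps).
have cross c : c \in t -> c \notin s -> exists p q r w,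
    [/\ s = [:: p; q; r; w], closed_segment p r c & closed_segment q w c].
  move=> ct cs; case: (corner c ct) => [[i ei]|[e [f [ee ff ef [ec fc]]]]].
    by move: cs; rewrite ei (mem_vertex ps).
  apply: (two_crossing_chords pol _ (mem_vertex ps e.1) (mem_vertex ps e.2)
    (mem_vertex ps f.1) (mem_vertex ps f.2) (edge_vertex_neq D ee) (edge_vertex_neq D ff) cs _ _ ec fc).
  - by rewrite szs.
  - case: e f ef {ee ff ec fc} => [i j] [k l] /= /eqP ef [/vertex_inj ki /vertex_inj lj].
    by apply: ef; rewrite ki lj.
  - case: e f ee ff {ef ec fc} => [i j] [k l] /= ij kl [/vertex_inj ki /vertex_inj lj].
    by move: kl; rewrite ki lj => ji; have := ltn_trans ij ji; rewrite ltnn.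
have [/allP sub|/allPn[c ct cs]] := boolP (all [in s] t).
  by have := uniq_leq_size unt sub; rewrite szt szs leqNgt n5.
have [p [q [r [w [es cpr cqw]]]]] := cross c ct cs.
have sub : {subset t <= c :: s}.
  move=> c' ct'; have [c's|c's] := boolP (c' \in s); first by rewrite inE c's orbT.
  have [p' [q' [r' [w' [es' c1 c2]]]]] := cross c' ct' c's.
  move: es'; rewrite es => -[? ? ? ?]; subst p' q' r' w'.
  by rewrite (quad_crossing_unique _ c1 c2 cpr cqw) ?mem_head // -es.
(* The five corners exhaust the five points [c :: s], yet [c] lies strictly between the corners [p]
   and [r]. *)
have [|_ ts] := uniq_min_size unt sub; first by rewrite szt es.
have pT : p \in t by rewrite ts es !inE eqxx orbT.
have rT : r \in t by rewrite ts es !inE eqxx !orbT.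
have pr : p != r.
  by have := polygon_uniq pol; rewrite es /= !inE !negb_or => /andP[/and3P[]].
have [k [/andP[k0 k1] ec]] := (closed_segmentP p r c).1 cpr.
have kn0 : k != 0 by apply: contraNneq cs => e; rewrite ec e between0 es !inE eqxx.
have kn1 : k != 1 by apply: contraNneq cs => e; rewrite ec e between1 es !inE eqxx !orbT.
have k01 : 0 < k < 1 by rewrite !lt_neqAle k0 k1 eq_sym kn0 kn1.
have := polygon_extreme polt (polygon_inhull polt pT) (polygon_inhull polt rT) pr k01.
by rewrite -ec ct.
Qed.

Lemma exists_pentagon_face : generic_drawing D -> (5 <= n)%N ->
  exists F : set pt, is_kface D 5 F.
Proof.
move=> gen n5; have n2 : (2 < n)%N by apply: leq_trans n5.
have [s pol ps] := convex_position_polygon hconv n2.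
have szs : size s = n by rewrite (perm_size ps) size_codom card_ord.
have s5 : (4 < size s)%N by rewrite szs.
have [F [ds [dis cov hds [P PF szP]]]] := exists_pentagonal_face pol (drawing_generic pol ps gen) s5.
exists [set x | inhull_strict P x]; rewrite -szP.
by apply: (face_kface _ pol ps dis cov hds PF); apply: leq_trans n5.
Qed.
End Final.

Theorem theorem2 (R : realType) (n : nat) (hn : (0 < n)%N)
    (D : rectilinear_drawing R n)
    (hconv : convex_drawing D) (hgen : generic_drawing D) :
  (exists F : set (plane R), is_kface D 5 F) <-> (5 <= n)%N.
Proof.
split=> [[F hF]|]; first exact: (pentagon_face_vertices hconv hF).
exact: exists_pentagon_face.
Qed.
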